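(* Let $a,b\in\mathbb{C}$ with $\Re(a)>1$, $\Re(b)>1$ and $a,b\notin\{2,3,4,\ldots\}$. Then $$\int_0^1 \zeta_1(a,x)\,\zeta_1(b,x)\,dx=\frac{1}{a+b-1}+\bigl\{B(a+b-1,1-a)+B(a+b-1,1-b)\bigr\}\,\zeta(a+b-1)$$ $$\qquad-\sum_{n=0}^\infty\frac{(a)_n}{(1-b)_{n+1}}\{\zeta(a+n)-1\}-\sum_{n=0}^\infty\frac{(b)_n}{(1-a)_{n+1}}\{\zeta(b+n)-1\}.$$
   Context: For $\Re(a)>1$ and $x\in[0,1]$, the auxiliary Hurwitz zeta function is $\zeta_1(a,x)=\sum_{k=1}^\infty (k+x)^{-a}=\zeta(a,x+1)$; for $x\in(0,1]$ it equals $\zeta(a,x)-x^{-a}$, where $\zeta(a,x)$ is the Hurwitz zeta function. $\zeta(s)$ is the Riemann zeta function, $(c)_n=c(c+1)\cdots(c+n-1)$ (with $(c)_0=1$) is the Pochhammer symbol, and $B(x,y)=\Gamma(x)\Gamma(y)/\Gamma(x+y)$ is the beta function (extended meromorphically through gamma functions). *)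

(* Defs.v *)
From Stdlib Require Import Reals.
From Coquelicot Require Import Coquelicot.
Open Scope R_scope.

Definition Cexp (z : C) : C :=
  (exp (Re z) * cos (Im z), exp (Re z) * sin (Im z)).

(** [x ^ s] with the principal branch, meaningful for [0 < x] only. *)
Definition Rcpow (x : R) (s : C) : C := Cexp (s * RtoC (ln x))%C.

Definition Cex_series (u : nat -> C) : Prop :=
  ex_series (V := C_R_NormedModule) u.

(** As for [RInt] and [Lim_seq], the value is the sum when the series converges
    and is irrelevant otherwise. *)
Definition CSeries (u : nat -> C) : C :=
  iota (T := C_R_CompleteNormedModule)
    (is_series (V := C_R_NormedModule) u).

Definition zeta1 (s : C) (x : R) : C :=
  CSeries (fun k : nat => Rcpow (INR (S k) + x) (- s)%C).

(** The Dirichlet series; meaningful for [1 < Re s] only. *)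
Definition zeta (s : C) : C :=
  CSeries (fun k : nat => Rcpow (INR (S k)) (- s)%C).

Fixpoint pochhammer (c : C) (n : nat) : C :=
  match n with
  | O => RtoC 1
  | S m => (pochhammer c m * (c + RtoC (INR m)))%C
  end.

(** Euler's integral over (0, +oo), improper at both ends; it converges for
    [0 < Re z]. *)
Definition Gamma_integral (z : C) : C :=
  RInt_gen (V := C_R_CompleteNormedModule)
    (fun t : R => (Rcpow t (z - RtoC 1) * RtoC (exp (- t)))%C)
    (at_right 0) (Rbar_locally p_infty).

(** The least natural number [N] with [0 < Re z + N]; it is 0 when [0 < Re z]
    ([up r] is the integer in the interval (r, r + 1]). *)
Definition Gamma_shift (z : C) : nat := Z.to_nat (up (- Re z)).

(** The meromorphic continuation of Euler's integral by the functional equation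
    [Gamma (z + N) = pochhammer z N * Gamma z]; at the poles 0, -1, -2, ... the
    denominator vanishes and the value is irrelevant. *)
Definition Gamma (z : C) : C :=
  (Gamma_integral (z + RtoC (INR (Gamma_shift z)))
     / pochhammer z (Gamma_shift z))%C.

Definition Beta (x y : C) : C := (Gamma x * Gamma y / Gamma (x + y))%C.

(** General term of the two series that are swapped into each other by
    exchanging [a] and [b]. *)
Definition zeta_term (a b : C) (n : nat) : C :=
  (pochhammer a n / pochhammer (RtoC 1 - b) (S n)
     * (zeta (a + RtoC (INR n)) - RtoC 1))%C.

(* Main.v *)
(** For [k > j] put [m = k - j]: unfolding both zeta functions and joining the unit
    intervals turns the off-diagonal terms into
    [J m a b = int_1^oo x^(-b) (x + m)^(-a) dx], while the diagonal gives
    [int_1^oo x^(-a-b) dx = 1 / (a + b - 1)].  Integrating [J] by parts [N] times,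
    [J m a b = (a)_N / (1-b)_N J m (a+N) (b-N) - sum_(n<N) (a)_n / (1-b)_(n+1) (1+m)^(-a-n)],
    and summing over [m] produces the partial sums of the series in [zeta (a+n) - 1].
    Instead of continuing the beta integral analytically one lets [N] tend to
    infinity: with [P = a + b - 1] and [x = m n / t],
    [(m n)^P J m (a+n) (b-n) = int_0^(m n) t^(P-1) (1 + t/n)^(-a-n) dt], which
    tends to [Gamma P] uniformly in [m], and
    [(a)_N / (1-b)_N N^(-P)] tends to [Gamma (1-b) / Gamma a].  The remainder thus
    tends to [Gamma P Gamma (1-b) / Gamma a * zeta P], which also proves that the
    series converges. *)

Require Import Defs.
From Stdlib Require Import Reals Factorial Lra Lia ssreflect.
From Coquelicot Require Import Coquelicot.
Open Scope R_scope.

(** * Limits, powers and integrals of complex-valued functions *)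

(** Two interchanges of limits shape the proof. First, $N$ tends to infinity under the sum over $m$.
    After $x=mn/t$ the shift $m$ survives only in the limits of integration, the upper one being
    $mn\ge n$. Hence the convergence to $\Gamma(P)$ is uniform in $m$, and the errors are small
    multiples of $m^{-\Re P}$, summable as $\Re P>1$. Second, truncating both zeta functions at $M$
    leaves integrals that stop at $1+M-m$. Each lost tail is $O(M^{-\Re a})$ and there are at most
    $M$ of them, so $\Re a>1$ makes them vanish. Parts can be repeated although $\Re(b-N)$ becomes
    negative, because convergence of $J$ at infinity depends on $\Re a+\Re b$ only. The excluded
    integers are those at which some denominator $(1-b)_n$ or $(1-a)_n$ vanishes. The limit of
    $(a)_N/(1-b)_N\,N^{-P}$ rests on $\Gamma(z+n+2)\sim n!\,n^{z+1}$, obtained from the moments of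
    $t/n$ under the density $t^ne^{-t}/n!$, which concentrates at $t=n$. Both $e^{-t}$ and
    $(1+t/n)^{-n}$ are dominated through one kernel, $t^{s-1}(1+t)^{-s-1}$, whose primitive is
    explicit. *)

Notation is_cint := (is_RInt (V := C_R_NormedModule)).
Notation cint := (RInt (V := C_R_CompleteNormedModule)).
Notation is_cderive := (is_derive (K := R_AbsRing) (V := C_R_NormedModule)).
Notation ccont := (continuous (T := R_UniformSpace) (U := C_R_NormedModule)).

Lemma C_ext (z w : C) : Re z = Re w -> Im z = Im w -> z = w.
Proof. destruct z, w; simpl; intros -> ->; reflexivity. Qed.

Lemma exp_le_exp x y : x <= y -> exp x <= exp y.
Proof. intros [H| ->]; [left; apply exp_increasing; exact H | right; reflexivity]. Qed.

(** Convergence to a complex limit along a filter, with [Cmod] in place of the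
    balls of the product uniform structure on [C]. *)
Definition tends {T : Type} (F : (T -> Prop) -> Prop) (f : T -> C) (l : C) : Prop :=
  forall eps : R, 0 < eps -> F (fun x => Cmod (f x - l) < eps).

Lemma tends_filterlim {T : Type} (F : (T -> Prop) -> Prop) {FF : Filter F} f l :
  filterlim f F (locally (T := C_R_NormedModule) l) <-> tends F f l.
Proof.
  rewrite (filterlim_locally_ball_norm (U := C_R_NormedModule)).
  unfold ball_norm; split.
  - intros H eps He. specialize (H (mkposreal eps He)).
    eapply filter_imp; [|exact H]. intros x Hx. simpl in Hx.
    rewrite Cmod_norm. exact Hx.
  - intros H eps. specialize (H eps (cond_pos eps)).
    eapply filter_imp; [|exact H]. intros x Hx. simpl in Hx.
    rewrite Cmod_norm in Hx. exact Hx.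
Qed.

Lemma tends_const {T : Type} (F : (T -> Prop) -> Prop) {FF : Filter F} (l : C) :
  tends F (fun _ => l) l.
Proof.
  intros eps He. apply filter_forall. intros _.
  replace (l - l)%C with (RtoC 0) by ring. rewrite Cmod_0. exact He.
Qed.

Lemma tends_ext {T : Type} (F : (T -> Prop) -> Prop) {FF : Filter F} f g l :
  F (fun x => f x = g x) -> tends F f l -> tends F g l.
Proof.
  intros Hfg Hf eps He.
  eapply filter_imp; [|apply filter_and; [exact Hfg | exact (Hf eps He)]].
  intros x [<- H]; exact H.
Qed.

Lemma tends_plus {T : Type} (F : (T -> Prop) -> Prop) {FF : Filter F} f g l m :
  tends F f l -> tends F g m -> tends F (fun x => f x + g x)%C (l + m)%C.
Proof.
  intros Hf Hg eps He.
  assert (He2 : 0 < eps / 2) by lra.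
  eapply filter_imp; [|apply filter_and; [exact (Hf _ He2) | exact (Hg _ He2)]].
  intros x [H1 H2].
  replace (f x + g x - (l + m))%C with ((f x - l) + (g x - m))%C by ring.
  eapply Rle_lt_trans; [apply Cmod_triangle|lra].
Qed.

Lemma tends_opp {T : Type} (F : (T -> Prop) -> Prop) {FF : Filter F} f l :
  tends F f l -> tends F (fun x => - f x)%C (- l)%C.
Proof.
  intros Hf eps He. eapply filter_imp; [|exact (Hf eps He)]. intros x H.
  cbv beta in *. replace (- f x - - l)%C with (- (f x - l))%C by ring.
  rewrite Cmod_opp. exact H.
Qed.

Lemma tends_minus {T : Type} (F : (T -> Prop) -> Prop) {FF : Filter F} f g l m :
  tends F f l -> tends F g m -> tends F (fun x => f x - g x)%C (l - m)%C.
Proof. intros Hf Hg. exact (tends_plus F _ _ _ _ Hf (tends_opp F _ _ Hg)). Qed.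

Lemma tends_mult {T : Type} (F : (T -> Prop) -> Prop) {FF : Filter F} f g l m :
  tends F f l -> tends F g m -> tends F (fun x => f x * g x)%C (l * m)%C.
Proof.
  intros Hf Hg eps He.
  pose proof (Cmod_ge_0 l) as Hl. pose proof (Cmod_ge_0 m) as Hm.
  set (d := Rmin 1 (eps / (1 + Cmod l + Cmod m))).
  assert (Hd0 : 0 < eps / (1 + Cmod l + Cmod m)) by (apply Rdiv_lt_0_compat; lra).
  assert (Hd : 0 < d) by (apply Rmin_case; lra).
  eapply filter_imp; [|apply filter_and; [exact (Hf _ Hd) | exact (Hg _ Hd)]].
  intros x [H1 H2].
  replace (f x * g x - l * m)%C with
    ((f x - l) * (g x - m) + ((f x - l) * m + l * (g x - m)))%C by ring.
  eapply Rle_lt_trans;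
    [eapply Rle_trans; [apply Cmod_triangle | apply Rplus_le_compat_l, Cmod_triangle]|].
  rewrite !Cmod_mult.
  pose proof (Cmod_ge_0 (f x - l)). pose proof (Cmod_ge_0 (g x - m)).
  assert (Hd1 : d <= 1) by apply Rmin_l.
  assert (Hd2 : d * (1 + Cmod l + Cmod m) <= eps).
  { assert (d <= eps / (1 + Cmod l + Cmod m)) by apply Rmin_r.
    apply (Rmult_le_compat_r (1 + Cmod l + Cmod m)) in H3; [|lra].
    replace (eps / (1 + Cmod l + Cmod m) * (1 + Cmod l + Cmod m)) with eps in H3
      by (field; lra). exact H3. }
  nra.
Qed.

Lemma tends_scal {T : Type} (F : (T -> Prop) -> Prop) {FF : Filter F} k f l :
  tends F f l -> tends F (fun x => k * f x)%C (k * l)%C.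
Proof. intros Hf. apply (tends_mult F); [apply tends_const; auto | exact Hf]. Qed.

Lemma tends_inv {T : Type} (F : (T -> Prop) -> Prop) {FF : Filter F} f l :
  l <> RtoC 0 -> tends F f l -> tends F (fun x => / f x)%C (/ l)%C.
Proof.
  intros Hl Hf eps He.
  apply Cmod_gt_0 in Hl as Hl'.
  set (d := Rmin (Cmod l / 2) (eps * (Cmod l * Cmod l) / 2)).
  assert (Hd : 0 < d).
  { apply Rmin_case; [lra|]. apply Rmult_lt_0_compat; [|lra].
    apply Rmult_lt_0_compat; [lra|nra]. }
  eapply filter_imp; [|exact (Hf _ Hd)].
  intros x H. cbv beta in *.
  assert (Hd1 : d <= Cmod l / 2) by apply Rmin_l.
  assert (Hd2 : d <= eps * (Cmod l * Cmod l) / 2) by apply Rmin_r.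
  assert (Hfl : Cmod l / 2 < Cmod (f x)).
  { assert (Cmod l <= Cmod (f x) + Cmod (f x - l)).
    { rewrite -(Cmod_opp (f x - l)). eapply Rle_trans; [|apply Cmod_triangle].
      right. f_equal. ring. }
    lra. }
  assert (Hf0 : f x <> RtoC 0) by (apply Cmod_gt_0; lra).
  replace (/ f x - / l)%C with ((- (f x - l)) / (f x * l))%C by (field; auto).
  rewrite Cmod_div; [|apply Cmult_neq_0; auto].
  rewrite Cmod_opp Cmod_mult.
  assert (0 < Cmod (f x) * Cmod l) by nra.
  apply Rlt_div_l; [lra|].
  assert (eps * (Cmod l * Cmod l / 2) < eps * (Cmod (f x) * Cmod l)).
  { apply Rmult_lt_compat_l; nra. }
  lra.
Qed.

Lemma tends_Cmod_le {T : Type} (F : (T -> Prop) -> Prop) {FF : ProperFilter' F} f l B :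
  tends F f l -> F (fun x => Cmod (f x) <= B) -> Cmod l <= B.
Proof.
  intros Hf HB. destruct (Rle_lt_dec (Cmod l) B) as [H|H]; [exact H|exfalso].
  apply (filter_not_empty (F := F)).
  assert (He : 0 < Cmod l - B) by lra.
  eapply filter_imp; [|apply filter_and; [exact (Hf _ He) | exact HB]].
  intros x [H1 H2]. cbv beta in *.
  assert (Cmod l <= Cmod (f x) + Cmod (f x - l)).
  { rewrite -(Cmod_opp (f x - l)). eapply Rle_trans; [|apply Cmod_triangle].
    right. f_equal. ring. }
  lra.
Qed.

Lemma tends_unique {T : Type} (F : (T -> Prop) -> Prop) {FF : ProperFilter' F} f l m :
  tends F f l -> tends F f m -> l = m.
Proof.
  intros H1 H2.
  assert (H : Cmod (l - m) <= 0).
  { apply (tends_Cmod_le F (fun x => f x - f x)%C).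
    - apply tends_minus; auto. apply FF.
    - eapply filter_imp; [|apply filter_true]. intros x _.
      replace (f x - f x)%C with (RtoC 0) by ring. rewrite Cmod_0; lra.
       }
  pose proof (Cmod_ge_0 (l - m)).
  assert (H3 : (l - m = 0)%C) by (apply Cmod_eq_0; lra).
  replace l with ((l - m) + m)%C by ring. rewrite H3. ring.
Qed.

Lemma tends_comp {T U : Type} (F : (T -> Prop) -> Prop) (G : (U -> Prop) -> Prop)
    (g : T -> U) f l :
  filterlim g F G -> tends G f l -> tends F (fun x => f (g x)) l.
Proof. intros Hg Hf eps He. exact (Hg _ (Hf eps He)). Qed.

Lemma tends_le {T : Type} (F : (T -> Prop) -> Prop) {FF : Filter F} f l (g : T -> R) :
  F (fun x => Cmod (f x - l) <= g x) -> filterlim g F (locally 0) -> tends F f l.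
Proof.
  intros Hf Hg eps He.
  specialize (Hg _ (locally_ball 0 (mkposreal eps He))). unfold filtermap in Hg.
  eapply filter_imp; [|apply filter_and; [exact Hf | exact Hg]].
  intros x [H1 H2]. rewrite /ball /= /AbsRing_ball /abs /minus /plus /opp /= in H2.
  apply Rabs_def2 in H2. lra.
Qed.

Lemma tends_RtoC {T : Type} (F : (T -> Prop) -> Prop) {FF : Filter F} (f : T -> R) (l : R) :
  filterlim f F (locally l) -> tends F (fun x => RtoC (f x)) (RtoC l).
Proof.
  intros Hf eps He.
  specialize (Hf _ (locally_ball l (mkposreal eps He))).
  eapply filter_imp; [|exact Hf]. intros x H.
  rewrite /ball /= /AbsRing_ball /abs /minus /plus /opp /= in H.
  cbv beta. rewrite -RtoC_minus Cmod_R. exact H.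
Qed.

(** * The complex exponential and powers of a positive real *)

Lemma Cexp_plus z w : (Cexp (z + w) = Cexp z * Cexp w)%C.
Proof.
  destruct z, w. unfold Cexp; simpl. rewrite exp_plus cos_plus sin_plus.
  apply C_ext; simpl; ring.
Qed.

Lemma Cmod_Cexp z : Cmod (Cexp z) = exp (Re z).
Proof.
  unfold Cmod, Cexp; simpl fst; simpl snd.
  replace ((exp (Re z) * cos (Im z)) ^ 2 + (exp (Re z) * sin (Im z)) ^ 2)
    with (Rsqr (exp (Re z)) * (Rsqr (sin (Im z)) + Rsqr (cos (Im z)))) by (unfold Rsqr; ring).
  rewrite sin2_cos2 Rmult_1_r. apply sqrt_Rsqr. left; apply exp_pos.
Qed.

Lemma Cexp_0 : Cexp 0 = 1%C.
Proof. unfold Cexp; simpl. rewrite exp_0 cos_0 sin_0. apply C_ext; simpl; ring. Qed.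

Lemma Cexp_RtoC x : Cexp (RtoC x) = RtoC (exp x).
Proof. unfold Cexp; simpl. rewrite cos_0 sin_0. apply C_ext; simpl; ring. Qed.

Lemma Rcpow_plus x s t : (Rcpow x (s + t) = Rcpow x s * Rcpow x t)%C.
Proof. unfold Rcpow. rewrite -Cexp_plus. f_equal. ring. Qed.

Lemma Rcpow_mult x y s : 0 < x -> 0 < y -> (Rcpow (x * y) s = Rcpow x s * Rcpow y s)%C.
Proof.
  intros Hx Hy. unfold Rcpow. rewrite -Cexp_plus ln_mult // RtoC_plus. f_equal. ring.
Qed.

Lemma Cmod_Rcpow x s : Cmod (Rcpow x s) = Rpower x (Re s).
Proof.
  unfold Rcpow, Rpower. rewrite Cmod_Cexp. f_equal. destruct s; simpl; ring.
Qed.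

Lemma Rcpow_0 x : Rcpow x 0 = 1%C.
Proof. unfold Rcpow. rewrite Cmult_0_l. apply Cexp_0. Qed.

Lemma Rcpow_1l s : Rcpow 1 s = 1%C.
Proof. unfold Rcpow. rewrite ln_1 Cmult_0_r. apply Cexp_0. Qed.

Lemma Rcpow_RtoC x y : Rcpow x (RtoC y) = RtoC (Rpower x y).
Proof. unfold Rcpow. rewrite -RtoC_mult. apply Cexp_RtoC. Qed.

Lemma Rcpow_neq_0 x s : Rcpow x s <> 0%C.
Proof.
  apply Cmod_gt_0. rewrite Cmod_Rcpow. apply exp_pos.
Qed.

Lemma Rcpow_opp x s : (Rcpow x (- s) = / Rcpow x s)%C.
Proof.
  assert (H : (Rcpow x (- s) * Rcpow x s = 1)%C).
  { rewrite -Rcpow_plus. replace (- s + s)%C with (RtoC 0) by ring. apply Rcpow_0. }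
  pose proof (Rcpow_neq_0 x s).
  replace (Rcpow x (- s)) with (Rcpow x (- s) * Rcpow x s / Rcpow x s)%C by (field; auto).
  rewrite H. field; auto.
Qed.

Lemma Rcpow_1 x : 0 < x -> Rcpow x 1 = RtoC x.
Proof. intros Hx. rewrite Rcpow_RtoC Rpower_1 //. Qed.

(** * Calculus of complex-valued functions of a real variable *)

Lemma is_cderive_pair (u v : R -> R) x du dv :
  is_derive u x du -> is_derive v x dv -> is_cderive (fun t => (u t, v t)) x (du, dv).
Proof.
  intros Hu Hv.
  apply (is_derive_ext (V := C_R_NormedModule)
    (fun t => plus (scal (u t) ((1, 0) : C_R_NormedModule)) (scal (v t) ((0, 1) : C_R_NormedModule)))).
  { intros t. apply C_ext; rewrite /= /scal /= /mult /= /plus /=; ring. }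
  replace ((du, dv) : C_R_NormedModule) with
    (plus (scal du ((1, 0) : C_R_NormedModule)) (scal dv ((0, 1) : C_R_NormedModule))).
  2: { apply C_ext; rewrite /= /scal /= /mult /= /plus /=; ring. }
  apply (is_derive_plus (V := C_R_NormedModule)).
  - apply (is_derive_scal_l (V := C_R_NormedModule)); exact Hu.
  - apply (is_derive_scal_l (V := C_R_NormedModule)); exact Hv.
Qed.

Lemma is_cderive_fst f x l : is_cderive f x l -> is_derive (fun t => fst (f t)) x (fst l).
Proof.
  intros H.
  apply (filterdiff_comp' (V := C_R_NormedModule) (W := R_NormedModule) f (fun z => fst z) x
    (fun y => scal y l) (fun z => fst z)) in H.
  - exact H.
  - apply filterdiff_linear. apply is_linear_fst.
Qed.

Lemma is_cderive_snd f x l : is_cderive f x l -> is_derive (fun t => snd (f t)) x (snd l).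
Proof.
  intros H.
  apply (filterdiff_comp' (V := C_R_NormedModule) (W := R_NormedModule) f (fun z => snd z) x
    (fun y => scal y l) (fun z => snd z)) in H.
  - exact H.
  - apply filterdiff_linear. apply is_linear_snd.
Qed.

(** The Leibniz rule is applied to the four products of real and imaginary parts, [C] being treated
    here as a real normed module only. *)
Lemma is_cderive_mult f g x df dg :
  is_cderive f x df -> is_cderive g x dg ->
  is_cderive (fun t => f t * g t)%C x (df * g x + f x * dg)%C.
Proof.
  intros Hf Hg.
  pose proof (is_cderive_fst _ _ _ Hf) as F1. pose proof (is_cderive_snd _ _ _ Hf) as F2.
  pose proof (is_cderive_fst _ _ _ Hg) as G1. pose proof (is_cderive_snd _ _ _ Hg) as G2.
  assert (K : forall n m : R_AbsRing, mult n m = mult m n) by (intros; apply Rmult_comm).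
  unfold Cmult. 
  replace (_ + _)%C with
   ((minus (plus (mult (fst df) (fst (g x))) (mult (fst (f x)) (fst dg)))
      (plus (mult (snd df) (snd (g x))) (mult (snd (f x)) (snd dg))),
    plus (plus (mult (fst df) (snd (g x))) (mult (fst (f x)) (snd dg)))
      (plus (mult (snd df) (fst (g x))) (mult (snd (f x)) (fst dg)))) : C).
  2: { apply C_ext; rewrite /= /mult /= /minus /plus /opp /=; ring. }
  apply is_cderive_pair.
  - apply (is_derive_minus (V := R_NormedModule));
      apply (is_derive_mult (K := R_AbsRing)); assumption.
  - apply (is_derive_plus (V := R_NormedModule));
      apply (is_derive_mult (K := R_AbsRing)); assumption.
Qed.

Lemma is_cderive_RtoC f x l : is_derive f x l -> is_cderive (fun t => RtoC (f t)) x (RtoC l).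
Proof. intros H. apply is_cderive_pair; [exact H|]. apply (is_derive_const (V := R_NormedModule)). Qed.

Lemma is_cderive_const (c : C) x : is_cderive (fun _ => c) x (RtoC 0).
Proof. apply (is_derive_const (V := C_R_NormedModule)). Qed.

Lemma is_cderive_scal k f x df :
  is_cderive f x df -> is_cderive (fun t => k * f t)%C x (k * df)%C.
Proof.
  intros H. replace (k * df)%C with (0 * f x + k * df)%C by ring.
  apply is_cderive_mult; [apply is_cderive_const | exact H].
Qed.

Lemma is_cderive_Rcpow s x : 0 < x -> is_cderive (fun t => Rcpow t s) x (s * Rcpow x (s - 1))%C.
Proof.
  intros Hx. replace (s - 1)%C with (s + - (1))%C by ring.
  rewrite Rcpow_plus Rcpow_opp Rcpow_1 //.
  unfold Rcpow, Cexp.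
  (* The components of $s\,x^s/x$ in the form that differentiation produces: one term from the
     exponential factor and one from the angle. *)
  replace (s * _)%C with
    ((exp (Re (s * ln x)) * cos (Im (s * ln x)) * Re s / x
       - exp (Re (s * ln x)) * sin (Im (s * ln x)) * Im s / x,
      exp (Re (s * ln x)) * sin (Im (s * ln x)) * Re s / x
       + exp (Re (s * ln x)) * cos (Im (s * ln x)) * Im s / x) : C).
  2: { destruct s; apply C_ext; simpl; field; lra. }
  destruct s as [p q]; simpl. 
  apply is_cderive_pair; (auto_derive; [auto|]); unfold Rminus; field; lra.
Qed.

Lemma is_cderive_comp f (g : R -> R) x df dg :
  is_cderive f (g x) df -> is_derive g x dg ->
  is_cderive (fun t => f (g t)) x (RtoC dg * df)%C.
Proof.
  intros Hf Hg.
  replace (RtoC dg * df)%C with (scal dg (df : C_R_NormedModule)).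
  2: { destruct df; apply C_ext; rewrite /= /scal /= /mult /=; ring. }
  apply (is_derive_comp (V := C_R_NormedModule)); assumption.
Qed.

Lemma is_cderive_ccont f x l : is_cderive f x l -> ccont f x.
Proof. intros H. apply (ex_derive_continuous (V := C_R_NormedModule)). exists l; exact H. Qed.

Lemma ccont_tends (f : R -> C) x : ccont f x <-> tends (locally x) f (f x).
Proof. apply tends_filterlim. typeclasses eauto. Qed.

Lemma ccont_mult f g x : ccont f x -> ccont g x -> ccont (fun t => f t * g t)%C x.
Proof. intros Hf Hg. apply ccont_tends in Hf, Hg. apply ccont_tends. apply tends_mult; auto. typeclasses eauto. Qed.

Lemma ccont_plus f g x : ccont f x -> ccont g x -> ccont (fun t => f t + g t)%C x.
Proof. apply (continuous_plus (V := C_R_NormedModule)). Qed.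

Lemma ccont_minus f g x : ccont f x -> ccont g x -> ccont (fun t => f t - g t)%C x.
Proof. apply (continuous_minus (V := C_R_NormedModule)). Qed.

Lemma ccont_const c x : ccont (fun _ => c) x.
Proof. apply continuous_const. Qed.

Lemma ccont_RtoC (f : R -> R) x : continuous f x -> ccont (fun t => RtoC (f t)) x.
Proof. intros H. apply ccont_tends. apply tends_RtoC; [typeclasses eauto|exact H]. Qed.

Lemma ccont_Rcpow s x : 0 < x -> ccont (fun t => Rcpow t s) x.
Proof. intros Hx. eapply is_cderive_ccont. apply is_cderive_Rcpow; exact Hx. Qed.

Lemma ccont_Rcpow_comp s (g : R -> R) x :
  0 < g x -> continuous g x -> ccont (fun t => Rcpow (g t) s) x.
Proof.
  intros Hx Hg.
  apply (continuous_comp (V := R_UniformSpace) (W := C_R_NormedModule) g (fun y => Rcpow y s));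
    [exact Hg | apply ccont_Rcpow; exact Hx].
Qed.

Lemma is_cint_FTC f df a b :
  (forall x, Rmin a b <= x <= Rmax a b -> is_cderive f x (df x)) ->
  (forall x, Rmin a b <= x <= Rmax a b -> ccont df x) ->
  is_cint df a b (f b - f a)%C.
Proof. apply (is_RInt_derive (V := C_R_CompleteNormedModule)). Qed.

Lemma is_cint_scal k f a b l : is_cint f a b l -> is_cint (fun x => k * f x)%C a b (k * l)%C.
Proof.
  intros H.
  pose proof (is_RInt_fct_extend_fst _ _ _ _ H) as H1.
  pose proof (is_RInt_fct_extend_snd _ _ _ _ H) as H2.
  apply (is_RInt_fct_extend_pair (U := R_NormedModule) (V := R_NormedModule)); unfold Cmult; simpl.
  - apply (is_RInt_minus (V := R_NormedModule)); apply (is_RInt_scal (V := R_NormedModule)); assumption.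
  - apply (is_RInt_plus (V := R_NormedModule)); apply (is_RInt_scal (V := R_NormedModule)); assumption.
Qed.

Lemma is_cint_plus f g a b l m : is_cint f a b l -> is_cint g a b m ->
  is_cint (fun x => f x + g x)%C a b (l + m)%C.
Proof. apply (is_RInt_plus (V := C_R_NormedModule)). Qed.

Lemma is_cint_minus f g a b l m : is_cint f a b l -> is_cint g a b m ->
  is_cint (fun x => f x - g x)%C a b (l - m)%C.
Proof. apply (is_RInt_minus (V := C_R_NormedModule)). Qed.

Lemma is_cint_cont f a b : (forall x, Rmin a b <= x <= Rmax a b -> ccont f x) ->
  is_cint f a b (cint f a b).
Proof.
  intros H. apply (RInt_correct (V := C_R_CompleteNormedModule)).
  apply (ex_RInt_continuous (V := C_R_CompleteNormedModule)). exact H.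
Qed.

Lemma cint_unique f a b l : is_cint f a b l -> cint f a b = l.
Proof. apply (is_RInt_unique (V := C_R_CompleteNormedModule)). Qed.

Lemma is_cint_ext f g a b l : (forall x, Rmin a b < x < Rmax a b -> f x = g x) ->
  is_cint f a b l -> is_cint g a b l.
Proof. apply (is_RInt_ext (V := C_R_NormedModule)). Qed.

Lemma is_cint_Chasles f a b c l m : is_cint f a b l -> is_cint f b c m ->
  is_cint f a c (l + m)%C.
Proof. apply (is_RInt_Chasles (V := C_R_NormedModule)). Qed.

Lemma is_cint_Cmod_le f g a b l m : a <= b ->
  (forall x, a <= x <= b -> Cmod (f x) <= g x) ->
  is_cint f a b l -> is_RInt g a b m -> Cmod l <= m.
Proof.
  intros Hab H Hf Hg. rewrite Cmod_norm.
  apply (norm_RInt_le (V := C_R_NormedModule) f g a b l m Hab); auto.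
  intros x Hx. specialize (H x Hx). rewrite Cmod_norm in H. exact H.
Qed.

(** * Improper integrals on (0, +oo) and Euler's integral *)

Notation F0inf := (filter_prod (at_right 0) (Rbar_locally p_infty)).

Lemma F0inf_ordered (d T : R) : 0 < d ->
  F0inf (fun ab => 0 < fst ab /\ fst ab < d /\ T < snd ab /\ fst ab < snd ab).
Proof.
  intros Hd.
  apply (Filter_prod (at_right 0) (Rbar_locally p_infty) _
    (fun x => 0 < x /\ x < d) (fun y => Rmax T d < y)).
  - exists (mkposreal d Hd). intros y Hy Hy0.
    rewrite /ball /= /AbsRing_ball /abs /minus /plus /opp /= in Hy.
    apply Rabs_def2 in Hy. lra.
  - exists (Rmax T d). auto.
  - intros x y Hx Hy. simpl. pose proof (Rmax_l T d). pose proof (Rmax_r T d). lra.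
Qed.

Lemma tends_Cmod_le_Cmod {T : Type} (F : (T -> Prop) -> Prop) {FF : ProperFilter' F} f g l m :
  tends F f l -> tends F g m -> F (fun x => Cmod (f x) <= Cmod (g x)) -> Cmod l <= Cmod m.
Proof.
  intros Hf Hg H. destruct (Rle_lt_dec (Cmod l) (Cmod m)) as [H0|H0]; [exact H0|exfalso].
  apply (filter_not_empty (F := F)).
  assert (He : 0 < (Cmod l - Cmod m) / 2) by lra.
  eapply filter_imp; [|apply filter_and; [exact H | apply filter_and; [exact (Hf _ He) | exact (Hg _ He)]]].
  intros x [H1 [H2 H3]]. cbv beta in *.
  assert (Cmod l <= Cmod (f x) + Cmod (f x - l)).
  { rewrite -(Cmod_opp (f x - l)). eapply Rle_trans; [|apply Cmod_triangle].
    right. f_equal. ring. }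
  assert (Cmod (g x) <= Cmod m + Cmod (g x - m)).
  { eapply Rle_trans; [|apply Cmod_triangle]. right. f_equal. ring. }
  lra.
Qed.

(** Continuity is part of the notion because [cint] is a total function: it guarantees that every
    value [cint f a b] with positive endpoints is a true integral, so that linearity passes to the
    limit. *)
Definition gint (f : R -> C) (l : C) : Prop :=
  (forall t, 0 < t -> ccont f t) /\ tends F0inf (fun ab => cint f (fst ab) (snd ab)) l.

Lemma cint_pos f a b : 0 < a -> 0 < b -> (forall t, 0 < t -> ccont f t) ->
  is_cint f a b (cint f a b).
Proof.
  intros Ha Hb H. apply is_cint_cont. intros x Hx. apply H.
  assert (0 < Rmin a b) by (apply Rmin_case; lra). lra.
Qed.

Lemma F0inf_pos (P : R * R -> Prop) : (forall a b, 0 < a -> a < b -> P (a, b)) -> F0inf P.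
Proof.
  intros H. eapply filter_imp; [|apply (F0inf_ordered 1 0); lra].
  intros [a b] Hab; simpl in Hab. apply H; lra.
Qed.

Lemma gint_unique f l m : gint f l -> gint f m -> l = m.
Proof. intros [_ Hl] [_ Hm]. eapply (tends_unique F0inf); eauto. Qed.

Lemma gint_plus f g l m : gint f l -> gint g m -> gint (fun t => f t + g t)%C (l + m)%C.
Proof.
  intros [Cf Hf] [Cg Hg]. split.
  - intros t Ht. apply ccont_plus; auto.
  - eapply tends_ext; [typeclasses eauto| |apply (tends_plus F0inf _ _ _ _ Hf Hg)].
    apply F0inf_pos. intros a b Ha Hb. simpl. symmetry. apply cint_unique.
    apply is_cint_plus; apply cint_pos; auto; lra.
Qed.

Lemma gint_scal k f l : gint f l -> gint (fun t => k * f t)%C (k * l)%C.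
Proof.
  intros [Cf Hf]. split.
  - intros t Ht. apply ccont_mult; auto. apply ccont_const.
  - eapply tends_ext; [typeclasses eauto| |apply (tends_scal F0inf k _ _ Hf)].
    apply F0inf_pos. intros a b Ha Hb. simpl. symmetry. apply cint_unique.
    apply is_cint_scal; apply cint_pos; auto; lra.
Qed.

Lemma gint_ext f g l : (forall t, 0 < t -> f t = g t) -> gint f l -> gint g l.
Proof.
  intros H [Cf Hf]. split.
  - intros t Ht. apply (continuous_ext_loc (U := C_R_NormedModule) _ f t).
    + exists (mkposreal t Ht). intros y Hy. apply H.
      rewrite /ball /= /AbsRing_ball /abs /minus /plus /opp /= in Hy.
      apply Rabs_def2 in Hy. lra.
    + apply Cf; exact Ht.
  - eapply tends_ext; [typeclasses eauto| |exact Hf].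
    apply F0inf_pos. intros a b Ha Hb. simpl. symmetry. apply cint_unique.
    eapply is_cint_ext; [|apply cint_pos; [ | | exact Cf]]; try lra.
    intros x Hx. rewrite Rmin_left in Hx; [|lra]. apply H; lra.
Qed.

Lemma is_cint_RtoC g a b m : is_RInt g a b m -> is_cint (fun t => RtoC (g t)) a b (RtoC m).
Proof.
  intros H. apply (is_RInt_fct_extend_pair (U := R_NormedModule) (V := R_NormedModule)); simpl.
  - exact H.
  - pose proof (is_RInt_const (V := R_NormedModule) a b 0) as K.
    rewrite /scal /= /mult /= Rmult_0_r in K. exact K.
Qed.

Lemma gint_le f g l m : (forall t, 0 < t -> Cmod (f t) <= g t) ->
  gint f l -> (forall t, 0 < t -> continuous g t) -> gint (fun t => RtoC (g t)) m -> Cmod l <= Cmod m.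
Proof.
  intros H [Cf Hf] Cg [_ Hg].
  eapply (tends_Cmod_le_Cmod F0inf); [exact Hf | exact Hg |].
  apply F0inf_pos. intros a b Ha Hb. simpl.
  assert (Hi : is_RInt g a b (RInt g a b)).
  { apply (RInt_correct (V := R_CompleteNormedModule)).
    apply (ex_RInt_continuous (V := R_CompleteNormedModule)).
    intros x Hx. rewrite Rmin_left in Hx; [|lra]. apply Cg; lra. }
  rewrite (cint_unique _ _ _ _ (is_cint_RtoC _ _ _ _ Hi)) Cmod_R.
  eapply Rle_trans; [|apply Rle_abs].
  eapply is_cint_Cmod_le; [left; exact Hb | | apply cint_pos; [ | | exact Cf] | exact Hi]; try lra.
  intros x Hx. apply H; lra.
Qed.

Lemma gint_FTC F f la lb : (forall t, 0 < t -> is_cderive F t (f t)) ->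
  (forall t, 0 < t -> ccont f t) ->
  tends (at_right 0) F la -> tends (Rbar_locally p_infty) F lb -> gint f (lb - la)%C.
Proof.
  intros HF Cf Ha Hb. split; [exact Cf|].
  eapply (tends_ext F0inf (fun ab => F (snd ab) - F (fst ab))%C).
  - apply F0inf_pos. intros a b Ha0 Hb0. simpl. symmetry. apply cint_unique.
    apply is_cint_FTC; intros x Hx; rewrite Rmin_left in Hx; try lra; [apply HF | apply Cf]; lra.
  - apply (tends_minus F0inf).
    + apply (tends_comp F0inf (Rbar_locally p_infty) snd); [apply filterlim_snd | exact Hb].
    + apply (tends_comp F0inf (at_right 0) fst); [apply filterlim_fst | exact Ha].
Qed.

(** The density of [(t / (1 + t)) ^ s / s], which increases from [0] to [1 / s];
    it equals [t ^ (s - 1) * (1 + t) ^ (- s - 1)]. *)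
Definition kern (s t : R) : R := exp ((s - 1) * ln t - (s + 1) * ln (1 + t)).

Definition kernI (s t : R) : R := exp (s * (ln t - ln (1 + t))) / s.

Lemma is_derive_kernI s t : 0 < s -> 0 < t -> is_derive (kernI s) t (kern s t).
Proof.
  intros Hs Ht. unfold kernI, kern. auto_derive; [lra|].
  replace ((s - 1) * ln t - (s + 1) * ln (1 + t)) with
    (s * (ln t + - ln (1 + t)) + (- ln t + - ln (1 + t))) by ring.
  rewrite !exp_plus !exp_Ropp !exp_ln; try lra. field. lra.
Qed.

Lemma continuous_kern s t : 0 < t -> continuous (kern s) t.
Proof.
  intros Ht. apply (ex_derive_continuous (V := R_NormedModule)). unfold kern. auto_derive. lra.
Qed.

Lemma kernI_bounds s t : 0 < s -> 0 < t -> 0 < kernI s t <= / s.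
Proof.
  intros Hs Ht. unfold kernI, Rdiv.
  assert (H : 0 < / s) by (apply Rinv_0_lt_compat; exact Hs).
  assert (ln t < ln (1 + t)) by (apply ln_increasing; lra).
  assert (exp (s * (ln t - ln (1 + t))) <= 1).
  { apply (Rle_trans _ (exp 0)); [apply exp_le_exp; nra | rewrite exp_0; lra]. }
  pose proof (exp_pos (s * (ln t - ln (1 + t)))). split; nra.
Qed.

Lemma Rpower_tends_0 s : 0 < s -> filterlim (fun t => exp (s * ln t)) (at_right 0) (locally 0).
Proof.
  intros Hs. apply filterlim_locally. intros eps.
  assert (Hd : 0 < exp (ln eps / s)) by apply exp_pos.
  exists (mkposreal _ Hd). intros y Hy Hy0.
  rewrite /ball /= /AbsRing_ball /abs /minus /plus /opp /= in Hy |- *.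
  apply Rabs_def2 in Hy. rewrite Rabs_pos_eq.
  2: { pose proof (exp_pos (s * ln y)); lra. }
  rewrite Ropp_0 Rplus_0_r.
  rewrite -(exp_ln eps (cond_pos eps)). apply exp_increasing.
  assert (ln y < ln eps / s).
  { rewrite -(ln_exp (ln eps / s)). apply ln_increasing; lra. }
  apply (Rmult_lt_compat_l s) in H; [|lra].
  replace (s * (ln eps / s)) with (ln eps) in H by (field; lra). exact H.
Qed.

Lemma kernI_lim_0 s : 0 < s -> filterlim (kernI s) (at_right 0) (locally 0).
Proof.
  intros Hs.
  apply (filterlim_le_le (fun _ => 0) (kernI s) (fun t => / s * exp (s * ln t)) (Finite 0)).
  - exists (mkposreal 1 Rlt_0_1). intros t _ Ht.
    pose proof (kernI_bounds s t Hs Ht). split; [lra|].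
    unfold kernI, Rdiv. rewrite (Rmult_comm (/ s)).
    apply Rmult_le_compat_r; [left; apply Rinv_0_lt_compat; exact Hs|].
    apply exp_le_exp. 
    assert (0 <= ln (1 + t)) by (rewrite -ln_1; apply ln_le; lra). nra.
  - apply filterlim_const.
  - replace (Finite 0) with (Rbar_mult (/ s) 0).
    2: { simpl. f_equal. ring. }
    apply (filterlim_comp _ _ _ (fun t => exp (s * ln t)) (Rmult (/ s)) _ (Rbar_locally 0)).
    + apply Rpower_tends_0; exact Hs.
    + apply (filterlim_Rbar_mult_l (/ s) 0).
Qed.

Lemma kernI_lim_inf s : 0 < s -> filterlim (kernI s) (Rbar_locally p_infty) (locally (/ s)).
Proof.
  intros Hs.
  (* Squeeze: $\ln t-\ln(1+t)=-\ln(1+1/t)\ge-1/t$, so [kernI s t] lies between $e^{-s/t}/s$ and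
     $1/s$. *)
  assert (H : is_lim (fun t => - s * / t) p_infty 0).
  { replace (Finite 0) with (Rbar_mult (- s) 0) by (simpl; f_equal; ring).
    apply is_lim_scal_l. apply (is_lim_inv (fun t => t) p_infty p_infty); [apply is_lim_id|discriminate]. }
  assert (H1 : is_lim (fun t => exp (- s * / t)) p_infty 1).
  { rewrite -exp_0. apply is_lim_comp_continuous; [exact H|].
    apply (ex_derive_continuous (V := R_NormedModule)). auto_derive. auto. }
  apply (is_lim_scal_l _ (/ s)) in H1.
  simpl in H1. rewrite Rmult_1_r in H1.
  apply (filterlim_le_le (fun t => / s * exp (- s * / t)) (kernI s) (fun _ => / s) (Finite (/ s))).
  - exists 0. intros t Ht. pose proof (kernI_bounds s t Hs Ht). split; [|lra].
    unfold kernI, Rdiv. rewrite (Rmult_comm (/ s)).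
    apply Rmult_le_compat_r; [left; apply Rinv_0_lt_compat; exact Hs|].
    apply exp_le_exp.
    replace (1 + t) with (t * (1 + / t)) by (field; lra).
    assert (0 < / t) by (apply Rinv_0_lt_compat; lra).
    rewrite ln_mult; [|lra|lra].
    assert (ln (1 + / t) <= / t).
    { rewrite -{2}(ln_exp (/ t)). apply ln_le; [lra|]. apply exp_ineq1_le. }
    nra.
  - exact H1.
  - apply filterlim_const.
Qed.

Lemma cint_kern_le f s M a b : 0 < s -> 0 < a -> a <= b ->
  (forall t, 0 < t -> ccont f t) -> (forall t, 0 < t -> Cmod (f t) <= M * kern s t) ->
  Cmod (cint f a b) <= M * (kernI s b - kernI s a).
Proof.
  intros Hs Ha Hab Cf Hf.
  apply (is_cint_Cmod_le f (fun t => M * kern s t) a b).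
  - exact Hab.
  - intros x Hx. apply Hf. lra.
  - apply cint_pos; auto; lra.
  - apply (is_RInt_scal (V := R_NormedModule) (kern s) a b M).
    apply (is_RInt_derive (V := R_CompleteNormedModule) (kernI s)); intros x Hx; rewrite Rmin_left in Hx; try lra.
    + apply is_derive_kernI; lra.
    + apply continuous_kern; lra.
Qed.

Lemma kern_dom_nonneg f s M : (forall t, 0 < t -> Cmod (f t) <= M * kern s t) -> 0 <= M.
Proof.
  intros H. specialize (H 1 Rlt_0_1). pose proof (Cmod_ge_0 (f 1)).
  pose proof (exp_pos ((s - 1) * ln 1 - (s + 1) * ln (1 + 1))). unfold kern in H. nra.
Qed.

Lemma cint_kern_bound f s M a b : 0 < s -> 0 < a -> a <= b ->
  (forall t, 0 < t -> ccont f t) -> (forall t, 0 < t -> Cmod (f t) <= M * kern s t) ->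
  Cmod (cint f a b) <= M / s.
Proof.
  intros Hs Ha Hab Cf Hf.
  eapply Rle_trans; [apply (cint_kern_le f s M); auto|].
  apply Rmult_le_compat_l; [eapply kern_dom_nonneg; eauto|].
  pose proof (kernI_bounds s a Hs Ha). pose proof (kernI_bounds s b Hs). lra.
Qed.

(** Endpoints in either order, since the Cauchy criterion compares two intervals whose ends may
    interlace. *)
Lemma cint_kern_abs f s M a b : 0 < s -> 0 < a -> 0 < b ->
  (forall t, 0 < t -> ccont f t) -> (forall t, 0 < t -> Cmod (f t) <= M * kern s t) ->
  Cmod (cint f a b) <= M * Rabs (kernI s b - kernI s a).
Proof.
  intros Hs Ha Hb Cf Hf.
  pose proof (kern_dom_nonneg f s M Hf) as HM.
  destruct (Rle_dec a b) as [H|H].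
  - eapply Rle_trans; [apply (cint_kern_le f s M); auto|].
    apply Rmult_le_compat_l; [exact HM | apply Rle_abs].
  - replace (cint f a b) with (- cint f b a)%C.
    2: { apply (opp_RInt_swap (V := C_R_CompleteNormedModule)).
         eexists. apply cint_pos; auto. }
    rewrite Cmod_opp Rabs_minus_sym.
    eapply Rle_trans; [apply (cint_kern_le f s M); auto; lra|].
    apply Rmult_le_compat_l; [exact HM | apply Rle_abs].
Qed.

Lemma gint_kern_ex f s M : 0 < s -> (forall t, 0 < t -> ccont f t) ->
  (forall t, 0 < t -> Cmod (f t) <= M * kern s t) -> exists l, gint f l.
Proof.
  intros Hs Cf Hf.
  pose proof (kern_dom_nonneg f s M Hf) as HM.
  destruct (proj1 (filterlim_locally_cauchy (U := C_R_CompleteNormedModule) (F := F0inf)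
    (fun ab => cint f (fst ab) (snd ab)))) as [l Hl].
  - intros eps.
    (* Two intervals differ by one piece at each end. A piece costs at most [M] times an increment
       of [kernI], which is at most $2d$; the total $4dM$ is below [eps], and the [+ 1] covers
       [M = 0]. *)
    set (d := eps / (4 * (M + 1))).
    assert (Hd : 0 < d) by (apply Rdiv_lt_0_compat; [apply cond_pos | lra]).
    exists (fun ab => (0 < fst ab /\ fst ab < snd ab) /\
      (Rabs (kernI s (fst ab)) < d /\ Rabs (kernI s (snd ab) - / s) < d)).
    split.
    + apply filter_and.
      { apply F0inf_pos. simpl. auto. }
      apply filter_and.
      * apply (filterlim_fst (F := at_right 0) (G := Rbar_locally p_infty) (fun x => Rabs (kernI s x) < d)).
        pose proof (kernI_lim_0 s Hs _ (locally_ball 0 (mkposreal d Hd))) as H.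
        eapply filter_imp; [|exact H]. intros x Hx.
        rewrite /ball /= /AbsRing_ball /abs /minus /plus /opp /= Ropp_0 Rplus_0_r in Hx. exact Hx.
      * apply (filterlim_snd (F := at_right 0) (G := Rbar_locally p_infty) (fun x => Rabs (kernI s x - / s) < d)).
        exact (kernI_lim_inf s Hs _ (locally_ball (/ s) (mkposreal d Hd))).
    + intros [a b] [a' b'] [[Ha Hab] [H1 H2]] [[Ha' Hab'] [H1' H2']]. simpl in *.
      apply (norm_compat1 (V := C_R_NormedModule)).
      change (norm (minus (cint f a' b' : C_R_NormedModule) (cint f a b))) with
        (norm ((cint f a' b' - cint f a b)%C : C_R_NormedModule)).
      rewrite -Cmod_norm.
      assert (E : cint f a' b' = (cint f a' a + (cint f a b + cint f b b'))%C).
      { apply cint_unique. apply (is_cint_Chasles f a' a b'); [apply cint_pos; auto|].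
        apply (is_cint_Chasles f a b b'); apply cint_pos; auto; lra. }
      rewrite E.
      replace (cint f a' a + (cint f a b + cint f b b') - cint f a b)%C with
        (cint f a' a + cint f b b')%C by ring.
      eapply Rle_lt_trans; [apply Cmod_triangle|].
      pose proof (cint_kern_abs f s M a' a Hs Ha' Ha Cf Hf) as K1.
      assert (Hb : 0 < b) by lra. assert (Hb' : 0 < b') by lra.
      pose proof (cint_kern_abs f s M b b' Hs Hb Hb' Cf Hf) as K2.
      assert (K3 : Rabs (kernI s a - kernI s a') <= 2 * d).
      { eapply Rle_trans; [apply Rabs_triang|]. rewrite Rabs_Ropp. lra. }
      assert (K4 : Rabs (kernI s b' - kernI s b) <= 2 * d).
      { replace (kernI s b' - kernI s b) with ((kernI s b' - / s) + - (kernI s b - / s)) by ring.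
        eapply Rle_trans; [apply Rabs_triang|]. rewrite Rabs_Ropp. lra. }
      assert (K5 : (M + 1) * (4 * d) = eps) by (unfold d; field; lra).
      nra.
  - exists l. split; [exact Cf|].
    apply (tends_filterlim F0inf); exact Hl.
Qed.

(** Jensen's inequality for [ln] at [1] and [1 + u]. *)
Lemma ln_weighted_le u w : 0 <= u -> 0 <= w <= 1 -> w * ln (1 + u) <= ln (1 + w * u).
Proof.
  intros Hu Hw.
  assert (Hr : 0 < 1 + w * u) by nra.
  assert (L : forall x, 0 < x -> ln x <= x - 1).
  { intros x Hx. pose proof (exp_ineq1_le (ln x)) as H. rewrite exp_ln in H; [|lra]. lra. }
  (* [H1] and [H2] compare [ln] at $1$ and $1+u$ with its tangent at $1+wu$. This point is the mean
     of the other two with weights $1-w$ and $w$, so the weighted linear parts cancel ([H3]). *)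
  assert (H1 : ln 1 - ln (1 + w * u) <= 1 / (1 + w * u) - 1).
  { rewrite -ln_div; try lra. apply L. apply Rdiv_lt_0_compat; lra. }
  assert (H2 : ln (1 + u) - ln (1 + w * u) <= (1 + u) / (1 + w * u) - 1).
  { rewrite -ln_div; try lra. apply L. apply Rdiv_lt_0_compat; lra. }
  rewrite ln_1 in H1.
  assert (H3 : (1 - w) * (1 / (1 + w * u) - 1) + w * ((1 + u) / (1 + w * u) - 1) = 0).
  { field. lra. }
  nra.
Qed.

(** $(1+t/n)^n$ increases with $n$, so it is at least its value $(1+t/K)^K\ge((1+t)/K)^K$ at $n=K$.
    This lower bound does not involve $n$, and hence dominates all the $(1+t/n)^{-n}$ with $n\ge K$
    at once. *)
Lemma ln_compound_lower n K t : 1 <= K <= n -> 0 <= t ->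
  K * ln (1 + t) - K * ln K <= n * ln (1 + t / n).
Proof.
  intros HK Ht.
  assert (Hn : 0 < / n) by (apply Rinv_0_lt_compat; lra).
  assert (HK' : 0 < / K) by (apply Rinv_0_lt_compat; lra).
  pose proof (ln_weighted_le (t / K) (K / n)) as H.
  replace (K / n * (t / K)) with (t / n) in H by (field; lra).
  assert (H1 : 0 <= t / K) by (unfold Rdiv; nra).
  assert (H2 : 0 <= K / n <= 1).
  { split; [unfold Rdiv; nra|]. apply Rle_div_l; lra. }
  specialize (H H1 H2).
  apply (Rmult_le_compat_l n) in H; [|lra].
  replace (n * (K / n * ln (1 + t / K))) with (K * ln (1 + t / K)) in H by (field; lra).
  assert (H3 : ln (1 + t) - ln K <= ln (1 + t / K)).
  { rewrite -ln_div; try lra. apply ln_le; [apply Rdiv_lt_0_compat; lra|].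
    unfold Rdiv. assert (K * / K = 1) by (field; lra). nra. }
  nra.
Qed.

Lemma ln_compound_upper n t : 0 < n -> 0 <= t -> n * ln (1 + t / n) <= t.
Proof.
  intros Hn Ht.
  assert (0 <= t / n) by (apply Rdiv_le_0_compat; lra).
  assert (ln (1 + t / n) <= t / n).
  { rewrite -{2}(ln_exp (t / n)). apply ln_le; [lra|]. apply exp_ineq1_le. }
  apply (Rmult_le_compat_l n) in H0; [|lra].
  replace (n * (t / n)) with t in H0 by (field; lra). exact H0.
Qed.

(** The two compound bounds at $n=K=s+1$ give $((1+t)/(s+1))^{s+1}\le(1+t/(s+1))^{s+1}\le e^t$. *)
Lemma gamma_kern_dom s t : 0 < s -> 0 < t ->
  exp ((s - 1) * ln t - t) <= exp ((s + 1) * ln (s + 1)) * kern s t.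
Proof.
  intros Hs Ht. unfold kern. rewrite -exp_plus. apply exp_le_exp.
  pose proof (ln_compound_lower (s + 1) (s + 1) t).
  pose proof (ln_compound_upper (s + 1) t). lra.
Qed.

Definition gamma_integrand (z : C) (t : R) : C :=
  (Rcpow t (z - RtoC 1) * RtoC (exp (- t)))%C.

Lemma Cmod_gamma_integrand z t : Cmod (gamma_integrand z t) = exp ((Re z - 1) * ln t - t).
Proof.
  unfold gamma_integrand. rewrite Cmod_mult Cmod_Rcpow Cmod_R Rabs_pos_eq; [|left; apply exp_pos].
  unfold Rpower. rewrite -exp_plus. f_equal.
Qed.

Lemma ccont_gamma_integrand z t : 0 < t -> ccont (gamma_integrand z) t.
Proof.
  intros Ht. apply ccont_mult; [apply ccont_Rcpow; exact Ht|].
  apply ccont_RtoC. apply (ex_derive_continuous (V := R_NormedModule)). auto_derive. auto.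
Qed.

Lemma gint_is_RInt_gen f l : gint f l ->
  is_RInt_gen (V := C_R_NormedModule) f (at_right 0) (Rbar_locally p_infty) l.
Proof.
  intros [Cf Hf]. intros P HP. unfold filtermapi.
  apply (tends_filterlim F0inf) in Hf.
  specialize (Hf P HP). unfold filtermap in Hf.
  eapply filter_imp; [|apply filter_and; [exact Hf | apply (F0inf_ordered 1 0); lra]].
  intros [a b] [H1 H2]; simpl in *. eexists. split; [|exact H1]. apply cint_pos; auto; lra.
Qed.

Lemma Gamma_integral_unique z l : gint (gamma_integrand z) l -> Gamma_integral z = l.
Proof.
  intros Hl. unfold Gamma_integral.
  change (fun t : R => (Rcpow t (z - RtoC 1) * RtoC (exp (- t)))%C) with (gamma_integrand z).
  refine (is_RInt_gen_unique (V := C_R_CompleteNormedModule) (gamma_integrand z) l _).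
  exact (gint_is_RInt_gen _ _ Hl).
Qed.

Lemma gint_Gamma z : 0 < Re z -> gint (gamma_integrand z) (Gamma_integral z).
Proof.
  intros Hz.
  destruct (gint_kern_ex (gamma_integrand z) (Re z) (exp ((Re z + 1) * ln (Re z + 1))) Hz) as [l Hl].
  - intros t Ht. apply ccont_gamma_integrand; exact Ht.
  - intros t Ht. rewrite Cmod_gamma_integrand. apply gamma_kern_dom; assumption.
  - rewrite (Gamma_integral_unique z l Hl). exact Hl.
Qed.

Lemma Gamma_integral_succ z : 0 < Re z -> Gamma_integral (z + 1) = (z * Gamma_integral z)%C.
Proof.
  intros Hz.
  assert (Hz1 : 0 < Re (z + 1)) by (destruct z; simpl in *; lra).
  assert (M : forall t, Cmod (Rcpow t z * RtoC (exp (- t))) = exp (Re z * ln t - t)).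
  { intros t. replace z with (z + 1 - 1)%C at 1 by ring.
    change (Cmod (gamma_integrand (z + 1) t) = exp (Re z * ln t - t)).
    rewrite Cmod_gamma_integrand. f_equal. destruct z; simpl; ring. }
  (* The integrand is the derivative of $t^ze^{-t}$, which vanishes at both ends; comparison with
     the two Euler integrals gives the functional equation. *)
  assert (H : gint (fun t => z * gamma_integrand z t + (- (1)) * gamma_integrand (z + 1) t)%C
    (RtoC 0 - RtoC 0)%C).
  { apply (gint_FTC (fun t => Rcpow t z * RtoC (exp (- t)))%C).
    - intros t Ht.
      replace (z * gamma_integrand z t + - (1) * gamma_integrand (z + 1) t)%C with
        (z * Rcpow t (z - 1) * RtoC (exp (- t)) + Rcpow t z * RtoC (- exp (- t)))%C.
      2: { unfold gamma_integrand. replace (z + 1 - 1)%C with z by ring.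
           rewrite RtoC_opp. ring. }
      apply (is_cderive_mult (fun t => Rcpow t z) (fun t => RtoC (exp (- t)))); [apply is_cderive_Rcpow; exact Ht|].
      apply is_cderive_RtoC. auto_derive; auto; ring.
    - intros t Ht. apply ccont_plus; apply ccont_mult;
        first [apply ccont_const | apply ccont_gamma_integrand; exact Ht].
    - apply (tends_le (at_right 0) _ _ (fun t => exp (Re z * ln t))).
      2: { apply Rpower_tends_0; exact Hz. }
      exists (mkposreal 1 Rlt_0_1). intros t _ Ht.
      replace (Rcpow t z * RtoC (exp (- t)) - 0)%C with (Rcpow t z * RtoC (exp (- t)))%C by ring.
      rewrite M. apply exp_le_exp. lra.
    (* Decay at infinity comes from [gamma_kern_dom] with $s=\Re z+1$: the kernel $t^{\Re
       z}(1+t)^{-\Re z-2}$ is at most $1/t$. *)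
    - apply (tends_le (Rbar_locally p_infty) _ _
        (fun t => exp ((Re z + 1 + 1) * ln (Re z + 1 + 1)) * / t)).
      + exists 0. intros t Ht.
        replace (Rcpow t z * RtoC (exp (- t)) - 0)%C with (Rcpow t z * RtoC (exp (- t)))%C by ring.
        rewrite M.
        replace (Re z * ln t - t) with ((Re z + 1 - 1) * ln t - t) by ring.
        eapply Rle_trans; [apply gamma_kern_dom; lra|].
        apply Rmult_le_compat_l; [left; apply exp_pos|].
        replace (/ t) with (exp (- ln t)) by (rewrite exp_Ropp exp_ln //).
        unfold kern. apply exp_le_exp.
        assert (ln t < ln (1 + t)) by (apply ln_increasing; lra).
        assert (0 <= ln (1 + t)) by (rewrite -ln_1; apply ln_le; lra). nra.
      + replace 0 with (exp ((Re z + 1 + 1) * ln (Re z + 1 + 1)) * 0) by ring.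
        apply (is_lim_scal_l _ _ p_infty 0).
        apply (is_lim_inv (fun t => t) p_infty p_infty); [apply is_lim_id|discriminate]. }
  pose proof (gint_plus _ _ _ _ (gint_scal z _ _ (gint_Gamma z Hz))
     (gint_scal (- (1))%C _ _ (gint_Gamma _ Hz1))) as H2.
  pose proof (gint_unique _ _ _ H H2) as E.
  replace (Gamma_integral (z + 1)) with
    (z * Gamma_integral z - (z * Gamma_integral z + - (1) * Gamma_integral (z + 1)))%C by ring.
  rewrite -E. ring.
Qed.

(** * Asymptotics of the gamma function *)

(** Mean value inequality along the segment from [w] to [z], where the modulus of the exponential is
    largest at an endpoint. *)
Lemma Cmod_Cexp_minus z w :
  Cmod (Cexp z - Cexp w) <= Cmod (z - w) * exp (Rmax (Re z) (Re w)).
Proof.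
  set (d := (z - w)%C).
  assert (HD : forall t, is_cderive (fun t => Cexp (w + RtoC t * d)) t (d * Cexp (w + RtoC t * d))%C).
  { intros t. destruct w as [w1 w2]. destruct d as [d1 d2]. unfold Cexp; simpl.
    replace (_ * _)%C with
     ((exp (w1 + (t * d1 - 0 * d2)) * cos (w2 + (t * d2 + 0 * d1)) * d1
        - exp (w1 + (t * d1 - 0 * d2)) * sin (w2 + (t * d2 + 0 * d1)) * d2,
       exp (w1 + (t * d1 - 0 * d2)) * sin (w2 + (t * d2 + 0 * d1)) * d1
        + exp (w1 + (t * d1 - 0 * d2)) * cos (w2 + (t * d2 + 0 * d1)) * d2) : C).
    2: { apply C_ext; simpl; ring. }
    apply is_cderive_pair; (auto_derive; [auto|]); unfold Rminus; ring. }
  assert (HI : is_cint (fun t => d * Cexp (w + RtoC t * d))%C 0 1 (Cexp z - Cexp w)%C).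
  { replace (Cexp z - Cexp w)%C with (Cexp (w + RtoC 1 * d) - Cexp (w + RtoC 0 * d))%C.
    2: { f_equal; [f_equal; unfold d; ring | f_equal; f_equal; ring]. }
    apply (is_cint_FTC (fun t => Cexp (w + RtoC t * d))).
    - intros x _. apply HD.
    - intros x _. apply ccont_mult; [apply ccont_const|]. eapply is_cderive_ccont. apply HD. }
  replace (Cmod d * exp (Rmax (Re z) (Re w))) with
    ((1 - 0) * (Cmod d * exp (Rmax (Re z) (Re w)))) by ring.
  rewrite Cmod_norm.
  apply (norm_RInt_le_const (V := C_R_NormedModule) (fun t => d * Cexp (w + RtoC t * d))%C 0 1); [lra| |exact HI].
  intros x Hx. rewrite -Cmod_norm Cmod_mult Cmod_Cexp.
  apply Rmult_le_compat_l; [apply Cmod_ge_0|]. apply exp_le_exp.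
  replace (Re (w + RtoC x * d)) with ((1 - x) * Re w + x * Re z).
  2: { unfold d. destruct w, z; simpl; ring. }
  pose proof (Rmax_l (Re z) (Re w)). pose proof (Rmax_r (Re z) (Re w)). nra.
Qed.

Lemma Gamma_integral_INR n : Gamma_integral (RtoC (INR (S n))) = RtoC (INR (fact n)).
Proof.
  induction n as [|n IH].
  - apply Gamma_integral_unique.
    apply (gint_ext (fun t => RtoC (exp (- t)))).
    { intros t Ht. unfold gamma_integrand. replace (RtoC (INR 1) - 1)%C with (RtoC 0) by (simpl; ring).
      rewrite Rcpow_0. ring. }
    replace (RtoC (INR (fact 0))) with (RtoC 0 - RtoC (- 1))%C.
    2: { rewrite -RtoC_minus. simpl. f_equal. ring. }
    apply (gint_FTC (fun t => RtoC (- exp (- t)))).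
    + intros t Ht. apply is_cderive_RtoC. auto_derive; auto; ring.
    + intros t Ht. apply ccont_RtoC. apply (ex_derive_continuous (V := R_NormedModule)). auto_derive. auto.
    + apply tends_RtoC; [typeclasses eauto|].
      replace (-1) with (- exp (- 0)) by (rewrite Ropp_0 exp_0; ring).
      eapply filterlim_filter_le_1; [apply filter_le_within|].
      apply (ex_derive_continuous (V := R_NormedModule) (fun t => - exp (- t)) 0). auto_derive. auto.
    + apply tends_RtoC; [typeclasses eauto|].
      replace 0 with (- 0) by ring.
      apply (is_lim_opp (fun t => exp (- t)) p_infty 0).
      apply (is_lim_comp exp (fun t => - t) p_infty 0 m_infty).
      * apply is_lim_exp_m.
      * apply (is_lim_opp (fun t => t) p_infty p_infty). apply is_lim_id.
      * exists 0. intros. discriminate.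
  - replace (RtoC (INR (S (S n)))) with (RtoC (INR (S n)) + 1)%C.
    2: { rewrite (S_INR (S n)) RtoC_plus. reflexivity. }
    rewrite Gamma_integral_succ.
    2: { change (0 < INR (S n)). apply lt_0_INR. lia. }
    rewrite IH -RtoC_mult -mult_INR. reflexivity.
Qed.

(** The $i$-th moment of $t/n$ under the probability density $t^ne^{-t}/n!$ on $(0,\infty)$. That
    all moments tend to $1$ expresses the concentration of this law at $t=n$. *)
Definition mu (n i : nat) : R := INR (fact (n + i)) / (INR (fact n) * INR n ^ i).

Lemma mu_lim i : is_lim_seq (fun n => mu n i) 1.
Proof.
  induction i as [|i IH].
  - apply (is_lim_seq_ext (fun _ => 1)); [|apply is_lim_seq_const].
    intros n. unfold mu. rewrite Nat.add_0_r. simpl. field. apply INR_fact_neq_0.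
  - apply (is_lim_seq_ext_loc (fun n => mu n i * (1 + INR (S i) * / INR n))).
    + exists 1%nat. intros n Hn. unfold mu.
      rewrite Nat.add_succ_r. rewrite [fact (S _)]/= -/fact.
      change (fact (n + i) + (n + i) * fact (n + i))%nat with (S (n + i) * fact (n + i))%nat.
      rewrite mult_INR !S_INR plus_INR. simpl pow. 
      assert (INR n <> 0) by (apply not_0_INR; lia).
      field. split; [apply pow_nonzero; auto|split; auto; apply INR_fact_neq_0].
    + replace (Finite 1) with (Finite (1 * (1 + INR (S i) * 0))) by (f_equal; ring).
      apply (is_lim_seq_mult _ _ 1 (1 + INR (S i) * 0)); [exact IH| |reflexivity].
      apply (is_lim_seq_plus _ _ 1 (INR (S i) * 0)); [apply is_lim_seq_const| |reflexivity].
      apply (is_lim_seq_scal_l _ (INR (S i)) 0).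
      apply (is_lim_seq_inv INR p_infty); [apply is_lim_seq_INR|discriminate].
Qed.

Definition gintR (g : R -> R) (m : R) : Prop :=
  (forall t, 0 < t -> continuous g t) /\ gint (fun t => RtoC (g t)) (RtoC m).

Lemma gintR_comb k f g l m : gintR f l -> gintR g m ->
  gintR (fun t => k * f t + g t) (k * l + m).
Proof.
  intros [Cf Hf] [Cg Hg]. split.
  - intros t Ht. apply (continuous_plus (V := R_NormedModule)); [|apply Cg; exact Ht].
    apply (continuous_scal_r (V := R_NormedModule) k f). apply Cf; exact Ht.
  - rewrite RtoC_plus RtoC_mult.
    apply (gint_ext (fun t => RtoC k * RtoC (f t) + RtoC (g t))%C).
    { intros t _. rewrite RtoC_plus RtoC_mult. reflexivity. }
    apply gint_plus; [apply gint_scal|]; assumption.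
Qed.

Lemma gintR_moment n i : (1 <= n)%nat ->
  gintR (fun t => t ^ n * exp (- t) * (t / INR n) ^ i) (INR (fact n) * mu n i).
Proof.
  intros Hn. assert (Hn0 : INR n <> 0) by (apply not_0_INR; lia).
  split.
  { intros t Ht. apply (ex_derive_continuous (V := R_NormedModule)). auto_derive. auto. }
  replace (INR (fact n) * mu n i) with (/ INR n ^ i * INR (fact (n + i))).
  2: { unfold mu. field. split; [apply pow_nonzero; auto | apply INR_fact_neq_0]. }
  rewrite RtoC_mult.
  apply (gint_ext (fun t => RtoC (/ INR n ^ i) * gamma_integrand (RtoC (INR (S (n + i)))) t)%C).
  { intros t Ht. unfold gamma_integrand.
    replace (RtoC (INR (S (n + i))) - 1)%C with (RtoC (INR (n + i))).
    2: { rewrite S_INR RtoC_plus. ring. }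
    rewrite Rcpow_RtoC Rpower_pow // -!RtoC_mult. f_equal.
    rewrite pow_add. unfold Rdiv. rewrite Rpow_mult_distr pow_inv. ring. }
  apply gint_scal. rewrite -Gamma_integral_INR. apply gint_Gamma.
  change (0 < INR (S (n + i))). apply lt_0_INR. lia.
Qed.

(** With [y = exp (2 w)], [(y - 1) ^ 2 / y = (exp w - exp (- w)) ^ 2 >= w ^ 2], and
    [Rabs (ln y) <= e / 2 + (ln y) ^ 2 / (2 e)]. *)
Lemma ln_abs_bound y e : 0 < y -> 0 < e ->
  y * Rabs (ln y) <= e / 2 * y + 2 / e * (y - 1) ^ 2.
Proof.
  intros Hy He.
  set (w := ln y / 2).
  assert (Ew : y = exp w * exp w).
  { rewrite -exp_plus. replace (w + w) with (ln y) by (unfold w; field). rewrite exp_ln //. }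
  assert (Ep : exp w * exp (- w) = 1) by (rewrite -exp_plus Rplus_opp_r exp_0; reflexivity).
  pose proof (exp_pos w) as P1. pose proof (exp_pos (- w)) as P2.
  assert (Hw : w ^ 2 <= (exp w - exp (- w)) ^ 2).
  { pose proof (exp_ineq1_le w). pose proof (exp_ineq1_le (- w)).
    destruct (Rle_dec 0 w).
    - assert (exp (- w) <= 1) by (rewrite -exp_0; apply exp_le_exp; lra). nra.
    - assert (exp w <= 1) by (rewrite -exp_0; apply exp_le_exp; lra). nra. }
  assert (Hl : y * (ln y) ^ 2 <= 4 * (y - 1) ^ 2).
  { replace (ln y) with (2 * w) by (unfold w; field).
    assert (y * (exp w - exp (- w)) ^ 2 = (y - 1) ^ 2).
    { rewrite {1}Ew. replace (exp w * exp w * (exp w - exp (- w)) ^ 2) with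
        ((exp w * exp w - exp w * exp (- w)) ^ 2) by ring. rewrite Ep -Ew. ring. }
    nra. }
  assert (Hs : Rabs (ln y) <= e / 2 + (ln y) ^ 2 * / (2 * e)).
  { rewrite -(pow2_abs (ln y)).
    assert (0 <= (Rabs (ln y) - e) ^ 2 * / (2 * e)).
    { apply Rmult_le_pos; [apply pow2_ge_0|]. left. apply Rinv_0_lt_compat. lra. }
    replace (e / 2 + Rabs (ln y) ^ 2 * / (2 * e)) with
      (Rabs (ln y) + (Rabs (ln y) - e) ^ 2 * / (2 * e)) by (field; lra). lra. }
  apply (Rmult_le_compat_l y) in Hs; [|lra].
  assert (0 < / (2 * e)) by (apply Rinv_0_lt_compat; lra).
  apply (Rmult_le_compat_r (/ (2 * e))) in Hl; [|lra].
  replace (2 / e * (y - 1) ^ 2) with (4 * (y - 1) ^ 2 * / (2 * e)) by (field; lra).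
  lra.
Qed.

(** A polynomial bound is wanted, as polynomials integrate to moments. By the mean value inequality
    the difference is at most $y\,|z|\,|\ln y|\max(1,y^{\Re z})$. The factor $y$, due to the
    exponent $z+1$ in place of $z$, tames the logarithm at $0$ through [ln_abs_bound]; it is also
    the origin of the shift [n + 2] below, since $\Gamma(z+n+2)=\int t^n e^{-t}\,t^{z+1}\,dt$. *)
Lemma Rcpow_near_1 z k y e : 0 <= Re z <= INR k -> 0 < y -> 0 < e ->
  Cmod (Rcpow y (z + 1) - RtoC y)
    <= Cmod z * (e / 2 * y + 2 / e * (y - 1) ^ 2) * (1 + y ^ k).
Proof.
  intros Hz Hy He.
  replace (Rcpow y (z + 1) - RtoC y)%C with (RtoC y * (Cexp (z * RtoC (ln y)) - Cexp 0))%C.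
  2: { rewrite Rcpow_plus Rcpow_1 // Cexp_0. unfold Rcpow. ring. }
  rewrite Cmod_mult Cmod_R Rabs_pos_eq; [|lra].
  eapply Rle_trans; [apply Rmult_le_compat_l; [lra | apply Cmod_Cexp_minus]|].
  replace (z * RtoC (ln y) - 0)%C with (z * RtoC (ln y))%C by ring.
  rewrite Cmod_mult Cmod_R.
  assert (HR : exp (Rmax (Re (z * RtoC (ln y))) (Re 0)) <= 1 + y ^ k).
  { replace (Re (z * RtoC (ln y))) with (Re z * ln y) by (destruct z; simpl; ring).
    simpl (Re 0).
    assert (Hyk : 0 < y ^ k) by (apply pow_lt; exact Hy).
    unfold Rmax. destruct (Rle_dec (Re z * ln y) 0); [rewrite exp_0; lra|].
    rewrite -(Rpower_pow k y Hy). unfold Rpower.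
    assert (exp (Re z * ln y) <= exp (INR k * ln y)); [|lra].
    apply exp_le_exp. assert (0 < ln y) by nra. nra. }
  pose proof (ln_abs_bound y e Hy He) as HL.
  pose proof (Cmod_ge_0 z). pose proof (Rabs_pos (ln y)).
  pose proof (exp_pos (Rmax (Re (z * RtoC (ln y))) (Re 0))).
  replace (y * (Cmod z * Rabs (ln y) * exp (Rmax (Re (z * ln y)) (Re 0)))) with
    (Cmod z * (y * Rabs (ln y)) * exp (Rmax (Re (z * RtoC (ln y))) (Re 0))) by ring.
  apply Rmult_le_compat; try lra.
  - apply Rmult_le_pos; nra.
  - apply Rmult_le_compat_l; lra.
Qed.

(** The integral of [t ^ n * exp (- t) * q (t / n)] is [INR (fact n)] times the
    value at the [mu n i] of the polynomial [q] bounding [Rcpow y (z + 1) - y] in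
    [Rcpow_near_1]; as [mu n i] tends to [1], the coefficient of [2 / e] tends
    to [0]. *)
Lemma Gamma_integral_ratio_bound z k e n : 0 <= Re z <= INR k -> 0 < e -> (1 <= n)%nat ->
  Cmod (Gamma_integral (z + RtoC (INR (n + 2))) / (RtoC (INR (fact n)) * Rcpow (INR n) (z + 1))
        - RtoC (mu n 1))
   <= Cmod z * Rabs (e / 2 * (mu n 1 + mu n (k + 1)) +
        2 / e * (mu n 2 - 2 * mu n 1 + mu n 0 + mu n (k + 2) - 2 * mu n (k + 1) + mu n k)).
Proof.
  intros Hz He Hn.
  assert (Hn0 : 0 < INR n) by (apply lt_0_INR; lia).
  assert (Hf0 : 0 < INR (fact n)) by (apply lt_0_INR, lt_O_fact).
  set (A := Cmod z). set (M i := gintR_moment n i Hn).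
  (* The bound of [Rcpow_near_1] expanded into monomials in $t/n$. [gintR_comb] leaves its last
     summand unscaled, hence the coefficient [A * (2 / e) - 1] before a second copy of the [k]-th
     moment. *)
  pose proof (gintR_comb (A * (e / 2)) _ _ _ _ (M 1%nat)
    (gintR_comb (A * (e / 2)) _ _ _ _ (M (k + 1)%nat)
    (gintR_comb (A * (2 / e)) _ _ _ _ (M 2%nat)
    (gintR_comb (- (2 * A * (2 / e))) _ _ _ _ (M 1%nat)
    (gintR_comb (A * (2 / e)) _ _ _ _ (M 0%nat)
    (gintR_comb (A * (2 / e)) _ _ _ _ (M (k + 2)%nat)
    (gintR_comb (- (2 * A * (2 / e))) _ _ _ _ (M (k + 1)%nat)
    (gintR_comb (A * (2 / e) - 1) _ _ _ _ (M k) (M k))))))))) as [Cg Hg].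
  cbv beta in Cg, Hg.
  assert (Hz2 : 0 < Re (z + RtoC (INR (n + 2)))).
  { rewrite plus_INR. destruct z; simpl in *. lra. }
  pose proof (gint_plus _ _ _ _
    (gint_scal (Rcpow (INR n) (- (z + 1))) _ _ (gint_Gamma _ Hz2))
    (gint_scal (- (1))%C _ _ (proj2 (M 1%nat)))) as Hf.
  assert (K : forall t, 0 < t ->
    (Rcpow (INR n) (- (z + 1)) * gamma_integrand (z + RtoC (INR (n + 2))) t
      + - (1) * RtoC (t ^ n * exp (- t) * (t / INR n) ^ 1) =
     RtoC (t ^ n * exp (- t)) * (Rcpow (t / INR n) (z + 1) - RtoC (t / INR n)))%C).
  { intros t Ht. unfold gamma_integrand.
    replace (z + RtoC (INR (n + 2)) - 1)%C with ((z + 1) + RtoC (INR n))%C.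
    2: { rewrite plus_INR RtoC_plus. simpl INR. rewrite !RtoC_plus. ring. }
    rewrite (Rcpow_plus t) (Rcpow_RtoC t) Rpower_pow // Rcpow_opp.
    assert (Ht' : 0 < t / INR n) by (apply Rdiv_lt_0_compat; lra).
    assert (E : Rcpow t (z + 1) = (Rcpow (t / INR n) (z + 1) * Rcpow (INR n) (z + 1))%C).
    { rewrite -Rcpow_mult //. f_equal. field. lra. }
    rewrite E. pose proof (Rcpow_neq_0 (INR n) (z + 1)).
    rewrite pow_1 !RtoC_mult. field. exact H. }
  apply (gint_ext _ _ _ K) in Hf.
  assert (HH' := fun H => gint_le _ _ _ _ H Hf Cg Hg). cbv beta in HH'.
  match type of HH' with ?P -> _ => assert (HP : P) end.
  { intros t Ht. 
    assert (Ht' : 0 < t / INR n) by (apply Rdiv_lt_0_compat; lra).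
    rewrite Cmod_mult Cmod_R.
    assert (Hp : 0 < t ^ n * exp (- t)).
    { apply Rmult_lt_0_compat; [apply pow_lt; exact Ht | apply exp_pos]. }
    rewrite Rabs_pos_eq; [|lra].
    eapply Rle_trans; [apply Rmult_le_compat_l; [lra | apply (Rcpow_near_1 z k _ e Hz Ht' He)]|].
    fold A. rewrite !pow_add. right. simpl. ring. }
  specialize (HH' HP). clear HP.
  replace (Gamma_integral _ / _ - _)%C with
   (RtoC (/ INR (fact n)) * (Rcpow (INR n) (- (z + 1)) * Gamma_integral (z + RtoC (INR (n + 2)))
     + - (1) * RtoC (INR (fact n) * mu n 1)))%C.
  2: { rewrite Rcpow_opp RtoC_mult RtoC_inv; [|lra].
       pose proof (Rcpow_neq_0 (INR n) (z + 1)).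
       assert (RtoC (INR (fact n)) <> 0%C) by (intros E; apply RtoC_inj in E; lra).
       field. auto. }
  rewrite Cmod_mult Cmod_R Rabs_pos_eq; [|left; apply Rinv_0_lt_compat; lra].
  apply (Rmult_le_compat_l (/ INR (fact n))) in HH'; [|left; apply Rinv_0_lt_compat; lra].
  eapply Rle_trans; [exact HH'|]. right.
  rewrite Cmod_R. fold A.
  match goal with |- _ = A * Rabs ?v => replace (A * Rabs v) with (Rabs (A * v)) end.
  2: { rewrite Rabs_mult (Rabs_pos_eq A) //. apply Cmod_ge_0. }
  match goal with |- / ?w * Rabs ?v = _ => replace (/ w * Rabs v) with (Rabs (/ w * v)) end.
  2: { rewrite Rabs_mult (Rabs_pos_eq (/ _)) //. left; apply Rinv_0_lt_compat; lra. }
  f_equal. field. lra.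
Qed.

Lemma INR_ge_ex r : exists k, r <= INR k.
Proof.
  destruct (INR_archimed 1 r Rlt_0_1) as [k Hk]. exists k. lra.
Qed.

Lemma Gamma_integral_asymptotic z : 0 <= Re z ->
  tends eventually (fun n =>
    Gamma_integral (z + RtoC (INR (n + 2))) / (RtoC (INR (fact n)) * Rcpow (INR n) (z + 1)))%C 1.
Proof.
  intros Hz eps Heps.
  destruct (INR_ge_ex (Re z)) as [k Hk].
  pose proof (Cmod_ge_0 z) as HA.
  (* For fixed [e] the bound tends to $|z|\,e$, as the coefficients multiplying [2 / e] sum to
     $1-2+1+1-2+1=0$. This [e] makes the limit less than [eps / 2]; the other half pays for
     replacing [mu n 1] by $1$. *)
  set (e := eps / (2 * (Cmod z + 1))).
  assert (He : 0 < e) by (apply Rdiv_lt_0_compat; lra).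
  assert (HL : is_lim_seq (fun n => Cmod z * Rabs (e / 2 * (mu n 1 + mu n (k + 1)) +
        2 / e * (mu n 2 - 2 * mu n 1 + mu n 0 + mu n (k + 2) - 2 * mu n (k + 1) + mu n k)))
     (Cmod z * Rabs (e / 2 * (1 + 1) + 2 / e * (1 - 2 * 1 + 1 + 1 - 2 * 1 + 1)))).
  { apply (is_lim_seq_scal_l _ _ (Finite _)). apply (is_lim_seq_abs _ (Finite _)).
    repeat first [apply mu_lim | apply is_lim_seq_minus' | apply is_lim_seq_plus'
      | apply (is_lim_seq_scal_l _ _ (Finite _))]. }
  replace (Rabs _) with e in HL.
  2: { rewrite Rabs_pos_eq; [lra|]. lra. }
  assert (HB : Cmod z * e < eps / 2).
  { replace (eps / 2) with ((Cmod z + 1) * e) by (unfold e; field; lra). nra. }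
  assert (Hd : 0 < eps / 2 - Cmod z * e) by lra.
  assert (He2 : 0 < eps / 2) by lra.
  pose proof (HL _ (locally_ball _ (mkposreal _ Hd))) as E1.
  pose proof (mu_lim 1 _ (locally_ball _ (mkposreal _ He2))) as E2.
  unfold filtermap in E1, E2.
  assert (E3 : eventually (fun n => (1 <= n)%nat)) by (exists 1%nat; auto).
  eapply filter_imp; [|exact (filter_and _ _ (filter_and _ _ E1 E2) E3)].
  intros n [[H1 H2] H3].
  rewrite /ball /= /AbsRing_ball /abs /minus /plus /opp /= in H1.
  rewrite /ball /= /AbsRing_ball /abs /minus /plus /opp /= in H2.
  pose proof (Gamma_integral_ratio_bound z k e n (conj Hz Hk) He H3) as H4.
  apply Rabs_def2 in H1.
  cbv beta. set (X := (Gamma_integral _ / _)%C) in *.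
  replace (X - 1)%C with ((X - RtoC (mu n 1)) + RtoC (mu n 1 + - (1)))%C.
  2: { rewrite RtoC_plus RtoC_opp. ring. }
  eapply Rle_lt_trans; [apply Cmod_triangle|]. rewrite (Cmod_R (_ + _)). lra.
Qed.

(** * The continued gamma function and ratios of Pochhammer symbols *)

Lemma pochhammer_plus z m n :
  pochhammer z (m + n) = (pochhammer z m * pochhammer (z + RtoC (INR m)) n)%C.
Proof.
  induction n as [|n IH].
  - rewrite Nat.add_0_r. simpl. ring.
  - rewrite Nat.add_succ_r. simpl pochhammer. rewrite IH plus_INR RtoC_plus. ring.
Qed.

Lemma pochhammer_neq_0 z n : (forall k, z <> RtoC (- INR k)) -> pochhammer z n <> 0%C.
Proof.
  intros Hz. induction n as [|n IH]; simpl.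
  - intros E. apply RtoC_inj in E. lra.
  - apply Cmult_neq_0; [exact IH|]. intros E. apply (Hz n).
    rewrite RtoC_opp. replace z with (z + RtoC (INR n) - RtoC (INR n))%C by ring.
    rewrite E. ring.
Qed.

Lemma Gamma_integral_plus z n : 0 < Re z ->
  Gamma_integral (z + RtoC (INR n)) = (pochhammer z n * Gamma_integral z)%C.
Proof.
  intros Hz. induction n as [|n IH].
  - simpl. replace (z + 0)%C with z by ring. ring.
  - rewrite S_INR RtoC_plus Cplus_assoc Gamma_integral_succ.
    + rewrite IH. simpl. ring.
    + pose proof (pos_INR n). destruct z; simpl in *. lra.
Qed.

Lemma Gamma_shift_pos z : 0 < Re (z + RtoC (INR (Gamma_shift z))).
Proof.
  unfold Gamma_shift. destruct (archimed (- Re z)) as [H _].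
  assert (IZR (up (- Re z)) <= INR (Z.to_nat (up (- Re z)))).
  { rewrite INR_IZR_INZ. apply IZR_le. lia. }
  destruct z; simpl in *. lra.
Qed.

(** [Gamma] fixes one particular shift $s$; any other $n$ reaching the right half-plane gives the
    same value. Both follow from expanding Euler's integral at $z+n+s$ from $z+n$ and from $z+s$,
    with $(z)_n(z+n)_s=(z)_s(z+s)_n$. *)
Lemma Gamma_pochhammer z n : (forall k, z <> RtoC (- INR k)) ->
  0 < Re (z + RtoC (INR n)) ->
  Gamma_integral (z + RtoC (INR n)) = (pochhammer z n * Gamma z)%C.
Proof.
  intros Hz Hn. unfold Gamma. set (s := Gamma_shift z).
  pose proof (Gamma_shift_pos z) as Hs. fold s in Hs.
  pose proof (Gamma_integral_plus _ s Hn) as E1.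
  pose proof (Gamma_integral_plus _ n Hs) as E2.
  assert (E3 : (z + RtoC (INR n) + RtoC (INR s) = z + RtoC (INR s) + RtoC (INR n))%C) by ring.
  rewrite E3 in E1. rewrite E1 in E2.
  pose proof (pochhammer_plus z n s) as P1. pose proof (pochhammer_plus z s n) as P2.
  rewrite Nat.add_comm P2 in P1.
  pose proof (pochhammer_neq_0 z n Hz). pose proof (pochhammer_neq_0 z s Hz).
  assert (H1 : pochhammer (z + RtoC (INR n)) s <> 0%C).
  { apply pochhammer_neq_0. intros k E. 
    assert (Re (z + RtoC (INR n)) = - INR k) by (rewrite E; reflexivity).
    pose proof (pos_INR k). lra. }
  replace (Gamma_integral (z + RtoC (INR n))) with
    (pochhammer (z + RtoC (INR n)) s * Gamma_integral (z + RtoC (INR n))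
      / pochhammer (z + RtoC (INR n)) s)%C by (field; exact H1).
  rewrite E2.
  replace (pochhammer (z + RtoC (INR s)) n) with
    (pochhammer z s * pochhammer (z + RtoC (INR s)) n / pochhammer z s)%C by (field; auto).
  rewrite P1. field. auto.
Qed.

(** The shift by [K] brings [z] into $\Re\ge0$, where the asymptotics of Euler's integral apply. *)
Lemma Gamma_asymptotic z K : (forall k, z <> RtoC (- INR k)) -> 0 <= Re z + INR K ->
  tends eventually (fun n =>
    pochhammer z (K + (n + 2)) * Gamma z
      / (RtoC (INR (fact n)) * Rcpow (INR n) (z + RtoC (INR K) + 1)))%C 1.
Proof.
  intros Hz HK.
  assert (HK' : 0 <= Re (z + RtoC (INR K))) by (destruct z; simpl in *; lra).
  eapply (tends_ext eventually); [|apply (Gamma_integral_asymptotic _ HK')].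
  apply filter_forall. intros n. cbv beta.
  replace (z + RtoC (INR K) + RtoC (INR (n + 2)))%C with (z + RtoC (INR (K + (n + 2))))%C.
  2: { rewrite (plus_INR K) RtoC_plus. ring. }
  rewrite Gamma_pochhammer; [reflexivity | exact Hz |].
  rewrite !plus_INR. pose proof (pos_INR n). destruct z; simpl in *; lra.
Qed.

(** A zero of [Gamma] would make the sequence of [Gamma_asymptotic] identically $0$, although it
    tends to $1$. *)
Lemma Gamma_neq_0 z : (forall k, z <> RtoC (- INR k)) -> Gamma z <> 0%C.
Proof.
  intros Hz E.
  destruct (INR_ge_ex (- Re z)) as [K HK].
  assert (HK' : 0 <= Re z + INR K) by lra.
  assert (H : RtoC 1 = RtoC 0).
  { eapply (tends_unique eventually); [apply (Gamma_asymptotic z K Hz HK')|].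
    eapply (tends_ext eventually); [|apply tends_const; typeclasses eauto].
    apply filter_forall. intros n. cbv beta. rewrite E. unfold Cdiv. ring. }
  apply RtoC_inj in H. lra.
Qed.

(** Quotient of two instances of [Gamma_asymptotic] with a common [K]: the factorials cancel and the
    powers leave $n^{c-a}$. The power is one of $n$, not of the index $K+n+2$. *)
Lemma pochhammer_ratio_lim a c K :
  (forall k, a <> RtoC (- INR k)) -> (forall k, c <> RtoC (- INR k)) ->
  0 <= Re a + INR K -> 0 <= Re c + INR K ->
  tends eventually (fun n =>
    pochhammer a (K + (n + 2)) / pochhammer c (K + (n + 2)) * Rcpow (INR n) (c - a))%C
    (Gamma c / Gamma a)%C.
Proof.
  intros Ha Hc HKa HKc.
  pose proof (Gamma_neq_0 a Ha). pose proof (Gamma_neq_0 c Hc).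
  assert (N1 : (RtoC 1 <> RtoC 0)%C) by (intros E; apply RtoC_inj in E; lra).
  pose proof (tends_mult eventually _ _ _ _ (Gamma_asymptotic a K Ha HKa)
    (tends_inv eventually _ _ N1 (Gamma_asymptotic c K Hc HKc))) as HT.
  apply (tends_scal eventually (Gamma c / Gamma a)) in HT.
  replace (Gamma c / Gamma a * (1 * / 1))%C with (Gamma c / Gamma a)%C in HT by (field; auto).
  eapply (tends_ext eventually); [|exact HT].
  exists 1%nat. intros n Hn. cbv beta.
  pose proof (pochhammer_neq_0 c (K + (n + 2)) Hc).
  assert (INR (fact n) <> 0) by apply INR_fact_neq_0.
  assert (RtoC (INR (fact n)) <> 0%C) by (intros E; apply RtoC_inj in E; auto).
  replace (c + RtoC (INR K) + 1)%C with ((c - a) + (a + RtoC (INR K) + 1))%C by ring.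
  rewrite (Rcpow_plus _ (c - a)).
  pose proof (Rcpow_neq_0 (INR n) (c - a)).
  pose proof (Rcpow_neq_0 (INR n) (a + RtoC (INR K) + 1)).
  field. auto 10.
Qed.

(** * The integrals [J m a b] *)

Lemma Cplus_minus_l (x y : C) : (x + y - x)%C = y.
Proof. ring. Qed.

Lemma Rpower_lim_inf s : s < 0 ->
  filterlim (fun x => Rpower x s) (Rbar_locally p_infty) (locally 0).
Proof.
  intros Hs. apply filterlim_locally. intros eps.
  exists (exp (ln eps / s)). intros x Hx.
  pose proof (exp_pos (ln eps / s)).
  rewrite /ball /= /AbsRing_ball /abs /minus /plus /opp /=.
  rewrite Ropp_0 Rplus_0_r Rabs_pos_eq; [|left; apply exp_pos].
  unfold Rpower. rewrite -(exp_ln eps (cond_pos eps)). apply exp_increasing.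
  assert (H1 : ln eps / s < ln x) by (rewrite -(ln_exp (ln eps / s)); apply ln_increasing; lra).
  replace (ln eps) with (s * (ln eps / s)) by (field; lra). nra.
Qed.

Lemma is_derive_Rpower_primitive p x : p <> 1 -> 0 < x ->
  is_derive (fun t => Rpower t (1 - p) / (1 - p)) x (Rpower x (- p)).
Proof.
  intros Hp Hx. unfold Rpower. auto_derive; [lra|].
  replace (exp (- p * ln x)) with (exp ((1 - p) * ln x) * exp (- ln x)).
  2: { rewrite -exp_plus. f_equal. ring. }
  rewrite exp_Ropp exp_ln //. field. lra.
Qed.

Lemma cint_tail_bound f M p L L' : 1 < p -> 0 < L <= L' -> 0 <= M ->
  (forall x, L <= x -> ccont f x) -> (forall x, L <= x -> Cmod (f x) <= M * Rpower x (- p)) ->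
  Cmod (cint f L L') <= M * (Rpower L (1 - p) / (p - 1)).
Proof.
  intros Hp HL HM Cf Hf.
  apply (Rle_trans _ (M * (Rpower L' (1 - p) / (1 - p) - Rpower L (1 - p) / (1 - p)))).
  - apply (is_cint_Cmod_le f (fun x => M * Rpower x (- p)) L L'); [lra| | |].
    + intros x Hx. apply Hf. lra.
    + apply is_cint_cont. intros x Hx. rewrite Rmin_left in Hx; [|lra]. apply Cf. lra.
    + apply (is_RInt_scal (V := R_NormedModule) (fun x => Rpower x (- p)) L L' M).
      apply (is_RInt_derive (V := R_CompleteNormedModule) (fun t => Rpower t (1 - p) / (1 - p)));
        intros x Hx; rewrite Rmin_left in Hx; try lra.
      * apply is_derive_Rpower_primitive; lra.
      * apply (ex_derive_continuous (V := R_NormedModule)). unfold Rpower. auto_derive. lra.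
  - apply Rmult_le_compat_l; [exact HM|].
    assert (0 < Rpower L' (1 - p)) by apply exp_pos.
    replace (Rpower L' (1 - p) / (1 - p)) with (- (Rpower L' (1 - p) / (p - 1))) by (field; lra).
    replace (Rpower L (1 - p) / (1 - p)) with (- (Rpower L (1 - p) / (p - 1))) by (field; lra).
    assert (0 < Rpower L' (1 - p) / (p - 1)) by (apply Rdiv_lt_0_compat; lra). lra.
Qed.

Lemma is_cint_ge1 f a b : 1 <= a -> 1 <= b -> (forall x, 1 <= x -> ccont f x) ->
  is_cint f a b (cint f a b).
Proof.
  intros Ha Hb H. apply is_cint_cont. intros x Hx. apply H.
  assert (1 <= Rmin a b) by (apply Rmin_case; lra). lra.
Qed.

Lemma cint_split f L L' : 1 <= L -> 1 <= L' -> (forall x, 1 <= x -> ccont f x) ->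
  cint f 1 L' = (cint f 1 L + cint f L L')%C.
Proof.
  intros HL HL' Cf. apply cint_unique.
  apply (is_cint_Chasles f 1 L L'); apply is_cint_ge1; auto; lra.
Qed.

Lemma improper_ex f M p : 1 < p -> 0 <= M ->
  (forall x, 1 <= x -> ccont f x) -> (forall x, 1 <= x -> Cmod (f x) <= M * Rpower x (- p)) ->
  exists l, tends (Rbar_locally p_infty) (fun L => cint f 1 L) l.
Proof.
  intros Hp HM Cf Hf.
  destruct (proj1 (filterlim_locally_cauchy (U := C_R_CompleteNormedModule) (F := Rbar_locally p_infty)
    (fun L => cint f 1 L))) as [l Hl].
  - intros eps.
    assert (Hlim : filterlim (fun L => M / (p - 1) * Rpower L (1 - p)) (Rbar_locally p_infty) (locally 0)).
    { replace 0 with (M / (p - 1) * 0) by ring.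
      apply (is_lim_scal_l _ _ p_infty 0). apply Rpower_lim_inf. lra. }
    specialize (Hlim _ (locally_ball 0 eps)). unfold filtermap in Hlim.
    exists (fun L => 1 < L /\ M / (p - 1) * Rpower L (1 - p) < eps). split.
    + apply filter_and; [exists 1; auto|].
      eapply filter_imp; [|exact Hlim]. intros L HL.
      rewrite /ball /= /AbsRing_ball /abs /minus /plus /opp /= in HL.
      apply Rabs_def2 in HL. lra.
    + assert (W : forall u v, 1 < u -> u <= v -> M / (p - 1) * Rpower u (1 - p) < eps ->
        Cmod (cint f 1 v - cint f 1 u) < eps).
      { intros u v Hu Huv He. rewrite (cint_split f u v); auto; try lra.
        rewrite Cplus_minus_l.
        eapply Rle_lt_trans; [apply (cint_tail_bound f M p u v); auto; try lra|].
        - intros x Hx; apply Cf; lra.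
        - intros x Hx; apply Hf; lra.
        - replace (M * (Rpower u (1 - p) / (p - 1))) with (M / (p - 1) * Rpower u (1 - p)) by (field; lra).
          exact He. }
      intros u v [Hu Hu'] [Hv Hv'].
      apply (norm_compat1 (V := C_R_NormedModule)).
      change (norm ((cint f 1 v - cint f 1 u)%C : C_R_NormedModule) < eps).
      rewrite -Cmod_norm. destruct (Rle_dec u v).
      * apply W; auto.
      * replace (cint f 1 v - cint f 1 u)%C with (- (cint f 1 u - cint f 1 v))%C by ring.
        rewrite Cmod_opp. apply W; auto; lra.
  - exists l. apply (tends_filterlim (Rbar_locally p_infty)). exact Hl.
Qed.

(** The domination is required only beyond [L], so that [M] may depend on [L]; [J_tail] relies on
    this. *)
Lemma improper_tail f M p L l : 1 < p -> 1 <= L -> 0 <= M ->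
  (forall x, 1 <= x -> ccont f x) -> (forall x, L <= x -> Cmod (f x) <= M * Rpower x (- p)) ->
  tends (Rbar_locally p_infty) (fun L => cint f 1 L) l ->
  Cmod (l - cint f 1 L) <= M * (Rpower L (1 - p) / (p - 1)).
Proof.
  intros Hp HL HM Cf Hf Hl.
  apply (tends_Cmod_le (Rbar_locally p_infty) (fun L' => cint f 1 L' - cint f 1 L)%C).
  - apply tends_minus; [typeclasses eauto | exact Hl | apply tends_const; typeclasses eauto].
  - exists L. intros L' HL'. rewrite (cint_split f L L'); auto; try lra.
    rewrite Cplus_minus_l.
    apply cint_tail_bound; auto; try lra. intros x Hx; apply Cf; lra.
Qed.

Definition jf (m : R) (a b : C) (x : R) : C := (Rcpow x (- b) * Rcpow (x + m) (- a))%C.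

Definition is_J (m : R) (a b l : C) : Prop :=
  tends (Rbar_locally p_infty) (fun L => cint (jf m a b) 1 L) l.

Definition J (m : R) (a b : C) : C := iota (T := C_R_CompleteNormedModule) (is_J m a b).

Lemma ccont_jf m a b x : 0 <= m -> 0 < x -> ccont (jf m a b) x.
Proof.
  intros Hm Hx. apply ccont_mult; [apply ccont_Rcpow; exact Hx|].
  apply ccont_Rcpow_comp; [lra|].
  apply (ex_derive_continuous (V := R_NormedModule)). auto_derive. auto.
Qed.

Lemma Cmod_jf m a b x : Cmod (jf m a b x) = Rpower x (- Re b) * Rpower (x + m) (- Re a).
Proof.
  unfold jf. rewrite Cmod_mult !Cmod_Rcpow. reflexivity.
Qed.

Lemma Rpower_le_opp x y s : 0 < x <= y -> 0 <= s -> Rpower y (- s) <= Rpower x (- s).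
Proof.
  intros H Hs. apply exp_le_exp. assert (ln x <= ln y) by (apply ln_le; lra). nra.
Qed.

Lemma J_unique m a b l : is_J m a b l -> J m a b = l.
Proof.
  intros H. apply (iota_unique (V := C_R_CompleteNormedModule)); [|exact H].
  intros y Hy. exact (tends_unique _ _ _ _ Hy H).
Qed.

(** As $(x+m)^{-\Re a}\le x^{-\Re a}$, only the sum $\Re a+\Re b$ matters, and $\Re b$ may be
    negative. Integration by parts moves $(a,b)$ to $(a+1,b-1)$ and preserves these hypotheses. *)
Lemma J_correct m a b : 0 <= m -> 0 <= Re a -> 1 < Re a + Re b -> is_J m a b (J m a b).
Proof.
  intros Hm Ha Hab.
  destruct (improper_ex (jf m a b) 1 (Re a + Re b)) as [l Hl]; [exact Hab | lra | | |].
  - intros x Hx. apply ccont_jf; lra.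
  - intros x Hx. rewrite Cmod_jf Rmult_1_l.
    replace (- (Re a + Re b)) with (- Re b + - Re a) by ring. rewrite Rpower_plus.
    apply Rmult_le_compat_l; [left; apply exp_pos|]. apply Rpower_le_opp; lra.
  - rewrite (J_unique m a b l Hl). exact Hl.
Qed.

(** Beyond [L] the factor $(x+m)^{-\Re a}$ is bounded by its value at [L] and only $x^{-\Re b}$ is
    integrated. What counts later is the decay in $L+m$. *)
Lemma J_tail m a b L : 0 <= m -> 0 <= Re a -> 1 < Re b -> 1 <= L ->
  Cmod (J m a b - cint (jf m a b) 1 L)
    <= Rpower (L + m) (- Re a) * (Rpower L (1 - Re b) / (Re b - 1)).
Proof.
  intros Hm Ha Hb HL. apply improper_tail; auto.
  - left; apply exp_pos.
  - intros x Hx. apply ccont_jf; lra.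
  - intros x Hx. rewrite Cmod_jf Rmult_comm.
    apply Rmult_le_compat_r; [left; apply exp_pos|]. apply Rpower_le_opp; lra.
  - apply J_correct; lra.
Qed.

Lemma J_by_parts m a b : 0 <= m -> 0 <= Re a -> 1 < Re a + Re b -> b <> RtoC 1 ->
  J m a b = (a / (1 - b) * J m (a + 1) (b - 1) - Rcpow (1 + m) (- a) / (1 - b))%C.
Proof.
  intros Hm Ha Hab Hb.
  assert (Hb' : (1 - b)%C <> 0%C).
  { intros E. apply Hb. replace b with (1 - (1 - b))%C by ring. rewrite E. ring. }
  (* Boundary term of the integration by parts: $O(x^{1-\Re a-\Re b})$ at infinity, and $(1+m)^{-a}$
     at $1$. *)
  set (F := fun x => (Rcpow x (1 - b) * Rcpow (x + m) (- a))%C).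
  assert (HI : forall L, 1 < L ->
    ((1 - b) * cint (jf m a b) 1 L + - a * cint (jf m (a + 1) (b - 1)) 1 L = F L - F 1)%C).
  { intros L HL.
    transitivity (cint (fun x => (1 - b) * jf m a b x + - a * jf m (a + 1) (b - 1) x)%C 1 L).
    - symmetry. apply cint_unique. apply is_cint_plus; apply is_cint_scal; apply is_cint_ge1; try lra;
        intros x Hx; apply ccont_jf; lra.
    - apply cint_unique. apply is_cint_FTC; intros x Hx; rewrite Rmin_left in Hx; try lra.
      + replace ((1 - b) * jf m a b x + - a * jf m (a + 1) (b - 1) x)%C with
          ((1 - b) * Rcpow x (1 - b - 1) * Rcpow (x + m) (- a) +
           Rcpow x (1 - b) * (RtoC 1 * (- a * Rcpow (x + m) (- a - 1))))%C.
        2: { unfold jf. replace (1 - b - 1)%C with (- b)%C by ring.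
             replace (- (b - 1))%C with (1 - b)%C by ring.
             replace (- (a + 1))%C with (- a - 1)%C by ring. ring. }
        apply (is_cderive_mult (fun x => Rcpow x (1 - b)) (fun x => Rcpow (x + m) (- a))).
        * apply is_cderive_Rcpow; lra.
        * apply (is_cderive_comp (fun y => Rcpow y (- a)) (fun y => y + m)).
          -- apply is_cderive_Rcpow; lra.
          -- auto_derive; auto; ring.
      + apply ccont_plus; apply ccont_mult; try apply ccont_const; apply ccont_jf; lra. }
  assert (HF : tends (Rbar_locally p_infty) F 0).
  { apply (tends_le (Rbar_locally p_infty) _ _ (fun x => Rpower x (1 - Re a - Re b))).
    - exists 0. intros x Hx. unfold F.
      replace (Rcpow x (1 - b) * Rcpow (x + m) (- a) - 0)%C with
        (Rcpow x (1 - b) * Rcpow (x + m) (- a))%C by ring.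
      rewrite Cmod_mult !Cmod_Rcpow.
      replace (1 - Re a - Re b) with (Re (1 - b) + - Re a) by (destruct b; simpl; ring).
      rewrite Rpower_plus. apply Rmult_le_compat_l; [left; apply exp_pos|].
      apply (Rpower_le_opp x (x + m)); lra.
    - apply Rpower_lim_inf. lra. }
  assert (Ha1 : 0 <= Re (a + 1) /\ 1 < Re (a + 1) + Re (b - 1)).
  { destruct a, b; simpl in *. lra. }
  assert (E : ((1 - b) * J m a b + - a * J m (a + 1) (b - 1) = 0 - F 1)%C).
  { apply (tends_unique (Rbar_locally p_infty) (fun L => F L - F 1)%C).
    - eapply (tends_ext (Rbar_locally p_infty)); [exists 1; intros L HL; apply HI; exact HL|].
      apply (tends_plus (Rbar_locally p_infty)); apply (tends_scal (Rbar_locally p_infty)); apply J_correct; lra.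
    - apply (tends_minus (Rbar_locally p_infty)); [exact HF | apply tends_const; typeclasses eauto]. }
  unfold F in E. rewrite Rcpow_1l in E.
  replace (J m a b) with
    (((1 - b) * J m a b + - a * J m (a + 1) (b - 1) + a * J m (a + 1) (b - 1)) / (1 - b))%C
    by (field; exact Hb').
  rewrite E. field. exact Hb'.
Qed.

(** The sum of the first [n] terms, whereas [sum_n u n] has [S n] terms. *)
Fixpoint Csum (u : nat -> C) (n : nat) : C :=
  match n with O => RtoC 0 | S k => (Csum u k + u k)%C end.

Lemma J_expansion m a b N : 0 <= m -> 0 <= Re a -> 1 < Re a + Re b ->
  (forall k, (1 - b)%C <> RtoC (- INR k)) ->
  J m a b = (pochhammer a N / pochhammer (1 - b) N * J m (a + RtoC (INR N)) (b - RtoC (INR N))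
    - Csum (fun n => pochhammer a n / pochhammer (1 - b) (S n) * Rcpow (1 + m) (- (a + RtoC (INR n)))) N)%C.
Proof.
  intros Hm Ha Hab Hb. induction N as [|N IH].
  - simpl. replace (a + 0)%C with a by ring. replace (b - 0)%C with b by ring. field.
  - rewrite {1}IH (J_by_parts m (a + RtoC (INR N)) (b - RtoC (INR N))).
    + replace (a + RtoC (INR (S N)))%C with (a + RtoC (INR N) + 1)%C by (rewrite S_INR RtoC_plus; ring).
      replace (b - RtoC (INR (S N)))%C with (b - RtoC (INR N) - 1)%C by (rewrite S_INR RtoC_plus; ring).
      simpl Csum. simpl pochhammer.
      replace (1 - (b - RtoC (INR N)))%C with (1 - b + RtoC (INR N))%C by ring.
      pose proof (pochhammer_neq_0 _ (S N) Hb) as HS. simpl in HS.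
      assert (H1 : pochhammer (1 - b) N <> 0%C) by (apply pochhammer_neq_0; exact Hb).
      assert (H2 : (1 - b + RtoC (INR N))%C <> 0%C).
      { intros E. apply HS. rewrite E. ring. }
      field. auto.
    + exact Hm.
    + pose proof (pos_INR N). destruct a; simpl in *; lra.
    + destruct a, b; simpl in *; lra.
    + intros E. apply (Hb N). replace (1 - b)%C with (1 - (b - RtoC (INR N)) - RtoC (INR N))%C by ring.
      rewrite E RtoC_opp. ring.
Qed.

Definition qf (P a : C) (n : nat) (t : R) : C :=
  (Rcpow t (P - 1) * Rcpow (1 + t / INR n) (- (a + RtoC (INR n))))%C.

Lemma ccont_qf P a n t : (1 <= n)%nat -> 0 < t -> ccont (qf P a n) t.
Proof.
  intros Hn Ht. assert (0 < INR n) by (apply lt_0_INR; lia).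
  apply ccont_mult; [apply ccont_Rcpow; exact Ht|].
  apply ccont_Rcpow_comp.
  - assert (0 < t / INR n) by (apply Rdiv_lt_0_compat; lra). lra.
  - apply (ex_derive_continuous (V := R_NormedModule)). auto_derive. lra.
Qed.

(** The exponents $-(a+n)\ln(1+t/n)$ and $-t$ differ by at most $(|a|+1)(1+t)^2/n$, while both
    exponentials are at most $K^K(1+t)^{-K}$. With $K=\Re P+3$ the square is absorbed and exactly
    the factor $(1+t)^{-\Re P-1}$ of the kernel is left. *)
Lemma qf_bound P a n t : 0 < Re P -> 0 <= Re a -> Re P + 3 <= INR n -> 0 < t ->
  Cmod (qf P a n t - gamma_integrand P t)
    <= (exp ((Re P + 3) * ln (Re P + 3)) * (Cmod a + 1) / INR n) * kern (Re P) t.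
Proof.
  intros HP Ha Hn Ht. set (K := Re P + 3) in *.
  assert (HK : 3 < K) by (unfold K; lra).
  set (w := ln (1 + t / INR n)).
  assert (Hu : 0 < t / INR n) by (apply Rdiv_lt_0_compat; lra).
  assert (Hw0 : 0 <= w) by (unfold w; rewrite -ln_1; apply ln_le; lra).
  assert (Hw1 : INR n * w <= t) by (apply ln_compound_upper; lra).
  (* With $u=t/n$: $\ln(1+u)\ge1-1/(1+u)\ge u-u^2$. *)
  assert (Hw2 : t - INR n * w <= t ^ 2 / INR n).
  { assert (1 - / (1 + t / INR n) <= w).
    { pose proof (exp_ineq1_le (- w)) as H. unfold w in H at 2.
      rewrite exp_Ropp exp_ln in H; lra. }
    assert (t / INR n - (t / INR n) ^ 2 <= 1 - / (1 + t / INR n)).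
    { set (u := t / INR n) in *.
      assert (E : 1 - / (1 + u) - (u - u ^ 2) = u ^ 3 * / (1 + u)) by (field; lra).
      assert (0 <= u ^ 3 * / (1 + u)).
      { apply Rmult_le_pos; [apply pow_le; lra | left; apply Rinv_0_lt_compat; lra]. }
      lra. }
    assert (H1 : t / INR n - (t / INR n) ^ 2 <= w) by lra.
    apply (Rmult_le_compat_l (INR n)) in H1; [|lra].
    replace (INR n * (t / INR n - (t / INR n) ^ 2)) with (t - t ^ 2 / INR n) in H1 by (field; lra).
    lra. }
  pose proof (ln_compound_lower (INR n) K t) as Hw3. fold w in Hw3.
  unfold qf, gamma_integrand.
  replace (Rcpow t (P - 1) * Rcpow (1 + t / INR n) (- (a + RtoC (INR n)))
            - Rcpow t (P - 1) * RtoC (exp (- t)))%C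
    with (Rcpow t (P - 1) * (Cexp (- (a + RtoC (INR n)) * RtoC w) - Cexp (RtoC (- t))))%C.
  2: { rewrite Cexp_RtoC. unfold Rcpow, w. ring. }
  rewrite Cmod_mult Cmod_Rcpow.
  assert (H1 : Cmod (- (a + RtoC (INR n)) * RtoC w - RtoC (- t)) <= (Cmod a + 1) * (1 + t) ^ 2 / INR n).
  { replace (- (a + RtoC (INR n)) * RtoC w - RtoC (- t))%C with
      (- (a * RtoC w) + RtoC (t - INR n * w))%C.
    2: { rewrite RtoC_minus RtoC_mult RtoC_opp. ring. }
    eapply Rle_trans; [apply Cmod_triangle|].
    rewrite Cmod_opp Cmod_mult !Cmod_R (Rabs_pos_eq w) // Rabs_pos_eq; [|lra].
    assert (Hw4 : w <= t / INR n) by (apply Rle_div_r; lra).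
    pose proof (Cmod_ge_0 a).
    apply (Rle_trans _ (Cmod a * (t / INR n) + t ^ 2 / INR n)); [nra|].
    replace (Cmod a * (t / INR n) + t ^ 2 / INR n) with ((Cmod a * t + t ^ 2) * / INR n) by (field; lra).
    apply Rmult_le_compat_r; [left; apply Rinv_0_lt_compat; lra|]. nra. }
  assert (H2 : exp (Rmax (Re (- (a + RtoC (INR n)) * RtoC w)) (Re (RtoC (- t))))
    <= exp (K * ln K - K * ln (1 + t))).
  { apply exp_le_exp. apply Rmax_lub.
    - replace (Re (- (a + RtoC (INR n)) * RtoC w)) with (- (Re a * w) - INR n * w) by (destruct a; simpl; ring).
      assert (1 <= K <= INR n) by (unfold K in *; lra).
      assert (0 <= Re a * w) by (apply Rmult_le_pos; lra). specialize (Hw3 H). lra.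
    - simpl. assert (1 <= K <= INR n) by (unfold K in *; lra). specialize (Hw3 H). lra. }
  eapply Rle_trans.
  { apply Rmult_le_compat_l; [left; apply exp_pos|].
    eapply Rle_trans; [apply Cmod_Cexp_minus|].
    apply Rmult_le_compat; [apply Cmod_ge_0 | left; apply exp_pos | exact H1 | exact H2]. }
  right. unfold kern, Rpower.
  replace (Re (P - 1)) with (Re P - 1) by (destruct P; simpl; ring).
  replace (exp (K * ln K - K * ln (1 + t))) with
    (exp (K * ln K) * exp (- ((Re P + 1) * ln (1 + t))) * / (1 + t) ^ 2).
  2: { assert (E2 : / (1 + t) ^ 2 = exp (- (2 * ln (1 + t)))).
       { rewrite exp_Ropp. f_equal. replace (2 * ln (1 + t)) with (ln (1 + t) + ln (1 + t)) by ring.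
         rewrite exp_plus exp_ln; [ring | lra]. }
       rewrite E2 -!exp_plus. f_equal. unfold K. ring. }
  unfold Rminus. rewrite exp_plus. field. lra.
Qed.

(** For $t=mn/x$ one has $1+t/n=(x+m)/x$, and the power $(mn)^P$ is what the change of variables
    needs. The new integrand [qf] is free of [m], which remains in the endpoints alone. *)
Lemma jf_subst m a b n L : (1 <= n)%nat -> 0 < m -> 1 < L ->
  (Rcpow (m * INR n) (a + b - 1) * cint (jf m (a + RtoC (INR n)) (b - RtoC (INR n))) 1 L)%C
    = cint (qf (a + b - 1) a n) (m * INR n / L) (m * INR n).
Proof.
  intros Hn Hm HL. assert (Hn0 : 0 < INR n) by (apply lt_0_INR; lia).
  assert (Hmn : 0 < m * INR n) by (apply Rmult_lt_0_compat; lra).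
  set (P := (a + b - 1)%C). set (q := m * INR n) in *.
  assert (HJ : is_cint (jf m (a + RtoC (INR n)) (b - RtoC (INR n))) 1 L
    (cint (jf m (a + RtoC (INR n)) (b - RtoC (INR n))) 1 L)).
  { apply is_cint_ge1; try lra. intros x Hx. apply ccont_jf; lra. }
  (* The map $x\mapsto q/x$ reverses orientation, from $q$ down to $q/L$. This sign is that of its
     derivative $-q/x^2$; [E2] turns the interval round at the end. *)
  apply (is_cint_scal (- Rcpow q P)%C) in HJ.
  pose proof (is_RInt_comp (V := C_R_CompleteNormedModule) (qf P a n) (fun x => q / x)
    (fun x => - q / x ^ 2) 1 L) as HC.
  rewrite Rmin_left in HC; [|lra]. rewrite Rmax_right in HC; [|lra].
  assert (HC' : is_cint (fun x => - Rcpow q P * jf m (a + RtoC (INR n)) (b - RtoC (INR n)) x)%C 1 L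
    (cint (qf P a n) (q / 1) (q / L))).
  { eapply is_cint_ext; [|apply HC].
    - intros x Hx. rewrite Rmin_left in Hx; [|lra]. rewrite Rmax_right in Hx; [|lra].
      assert (Hqx : 0 < q / x) by (apply Rdiv_lt_0_compat; lra).
      transitivity (RtoC (- q / x ^ 2) * qf P a n (q / x))%C.
      { destruct (qf P a n (q / x)). apply C_ext; rewrite /= /scal /= /mult /=; ring. }
      unfold qf, jf.
      replace (1 + q / x / INR n) with ((x + m) * / x) by (unfold q; field; lra).
      assert (Hx' : 0 < / x) by (apply Rinv_0_lt_compat; lra).
      unfold Rdiv. rewrite (Rcpow_mult q) // (Rcpow_mult (x + m)) //; [|lra].
      assert (Ei : forall s, Rcpow (/ x) s = Rcpow x (- s)).
      { intros s. rewrite Rcpow_opp. pose proof (Rcpow_neq_0 x s).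
        assert (E : (Rcpow (/ x) s * Rcpow x s = 1)%C).
        { rewrite -Rcpow_mult //; [|lra]. rewrite Rinv_l; [|lra]. apply Rcpow_1l. }
        replace (Rcpow (/ x) s) with (Rcpow (/ x) s * Rcpow x s / Rcpow x s)%C by (field; auto).
        rewrite E. field; auto. }
      rewrite !Ei.
      replace (RtoC (- q * / x ^ 2)) with (- Rcpow q 1 * Rcpow x (- (2)))%C.
      2: { rewrite Rcpow_1 // -!RtoC_opp Rcpow_RtoC -RtoC_mult. f_equal. f_equal.
           rewrite Rpower_Ropp. f_equal. change 2 with (INR 2). rewrite Rpower_pow //. lra. }
      assert (EP : Rcpow q P = (Rcpow q 1 * Rcpow q (P - 1))%C).
      { rewrite -Rcpow_plus. f_equal. ring. }
      rewrite EP.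
      replace (- (b - RtoC (INR n)))%C with
        (- (2) + (- (P - 1) + - - (a + RtoC (INR n))))%C by (unfold P; ring).
      rewrite !(Rcpow_plus x). refine (_ : @eq C _ _). ring.
    - intros x Hx. apply ccont_qf; [exact Hn|]. apply Rdiv_lt_0_compat; lra.
    - intros x Hx. split; [auto_derive; [lra|field; lra]|].
      apply (ex_derive_continuous (V := R_NormedModule)). auto_derive.
      intros E. assert (0 < x * (x * 1)) by nra. lra. }
  pose proof (cint_unique _ _ _ _ HJ) as E1. rewrite (cint_unique _ _ _ _ HC') in E1.
  replace (q / 1) with q in E1 by field.
  assert (E2 : cint (qf P a n) q (q / L) = (- cint (qf P a n) (q / L) q)%C).
  { assert (0 < q / L) by (apply Rdiv_lt_0_compat; lra).
    symmetry. apply (opp_RInt_swap (V := C_R_CompleteNormedModule)). eexists.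
    apply cint_pos; auto. intros t Ht. apply ccont_qf; auto. }
  rewrite E2 in E1.
  replace (cint (qf P a n) (q / L) q) with (- - cint (qf P a n) (q / L) q)%C by ring.
  rewrite E1. ring.
Qed.

(** For $m\ge1$ the interval $(mn/L,\,mn)$ always reaches beyond $n$, and its lower end goes to $0$
    as $L\to\infty$ for each [m]. So one threshold for [n] puts the gamma integral within [eps / 2]
    of its limit for every [m], and the error of [qf_bound] is free of [m] as well. *)
Lemma J_uniform a b eps : 0 <= Re a -> 1 < Re a + Re b -> 0 < eps ->
  eventually (fun n => forall m, 1 <= m ->
    Cmod (Rcpow (m * INR n) (a + b - 1) * J m (a + RtoC (INR n)) (b - RtoC (INR n))
          - Gamma_integral (a + b - 1)) <= eps).
Proof.
  intros Ha Hab He. set (P := (a + b - 1)%C).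
  assert (HP : 0 < Re P) by (unfold P; destruct a, b; simpl in *; lra).
  destruct (gint_Gamma P HP) as [Cg Hg].
  assert (He2 : 0 < eps / 2) by lra.
  destruct (Hg _ He2) as [Q Q' [d Hd] [T HT] HQ]. simpl in HQ.
  set (M := exp ((Re P + 3) * ln (Re P + 3)) * (Cmod a + 1)).
  assert (HM : 0 <= M).
  { apply Rmult_le_pos; [left; apply exp_pos | pose proof (Cmod_ge_0 a); lra]. }
  (* The summands serve in turn [qf_bound], the upper endpoint (beyond [T]), positivity of [n], and
     the error $M/(n\,\Re P)\le$ [eps / 2]. *)
  destruct (INR_ge_ex (Re P + 3 + Rmax T 0 + 1 + M / Re P * (2 / eps))) as [n0 Hn0].
  exists n0. intros n Hn m Hm.
  apply le_INR in Hn.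
  assert (H0 : 0 <= M / Re P * (2 / eps)).
  { apply Rmult_le_pos; [apply Rdiv_le_0_compat; lra | left; apply Rdiv_lt_0_compat; lra]. }
  pose proof (Rmax_l T 0). pose proof (Rmax_r T 0).
  assert (Hnat : (1 <= n)%nat) by (apply INR_le; simpl; lra).
  assert (Hmn : 0 < m * INR n) by (apply Rmult_lt_0_compat; lra).
  assert (Hmn' : INR n <= m * INR n) by nra.
  apply (tends_Cmod_le (Rbar_locally p_infty) (fun L =>
    Rcpow (m * INR n) P * cint (jf m (a + RtoC (INR n)) (b - RtoC (INR n))) 1 L - Gamma_integral P)%C).
  { apply (tends_minus (Rbar_locally p_infty)); [|apply tends_const; typeclasses eauto].
    apply (tends_scal (Rbar_locally p_infty)). apply J_correct; [lra| |];
      pose proof (pos_INR n); destruct a, b; simpl in *; lra. }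
  exists (Rmax 1 (m * INR n / d)). intros L HL.
  pose proof (Rmax_l 1 (m * INR n / d)). pose proof (Rmax_r 1 (m * INR n / d)).
  pose proof (cond_pos d) as Hd0.
  assert (HLd : m * INR n / L < d).
  { apply Rlt_div_l; [lra|]. assert (H5 : m * INR n / d < L) by lra.
    apply Rlt_div_l in H5; lra. }
  assert (HL0 : 0 < m * INR n / L) by (apply Rdiv_lt_0_compat; lra).
  rewrite jf_subst; auto; try lra. fold P.
  assert (HG : Cmod (cint (gamma_integrand P) (m * INR n / L) (m * INR n) - Gamma_integral P) < eps / 2).
  { apply HQ.
    - apply Hd; [|exact HL0]. rewrite /ball /= /AbsRing_ball /abs /minus /plus /opp /=.
      rewrite Ropp_0 Rplus_0_r Rabs_pos_eq; lra.
    - apply HT. lra. }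
  assert (HD : Cmod (cint (fun t => qf P a n t - gamma_integrand P t)%C (m * INR n / L) (m * INR n))
     <= M / INR n / Re P).
  { apply cint_kern_bound; auto.
    - apply Rle_div_l; [lra|]. nra.
    - intros t Ht. apply ccont_minus; [apply ccont_qf | apply ccont_gamma_integrand]; auto.
    - intros t Ht. apply qf_bound; auto; lra. }
  assert (ED : cint (fun t => qf P a n t - gamma_integrand P t)%C (m * INR n / L) (m * INR n)
    = (cint (qf P a n) (m * INR n / L) (m * INR n) - cint (gamma_integrand P) (m * INR n / L) (m * INR n))%C).
  { apply cint_unique. apply is_cint_minus; apply cint_pos; auto.
    intros t Ht. apply ccont_qf; auto. }
  rewrite ED in HD.
  assert (HM2 : M / INR n / Re P <= eps / 2).
  { replace (M / INR n / Re P) with ((M / Re P * (2 / eps)) * (eps / 2) / INR n) by (field; lra).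
    apply Rle_div_l; [lra|].
    rewrite (Rmult_comm (eps / 2) (INR n)). apply Rmult_le_compat_r; lra. }
  set (x := cint (qf P a n) _ _) in *. set (y := cint (gamma_integrand P) _ _) in *.
  replace (x - Gamma_integral P)%C with ((x - y) + (y - Gamma_integral P))%C by ring.
  eapply Rle_trans; [apply Cmod_triangle|]. lra.
Qed.

(** * Summation over [m] *)

Definition is_csum (u : nat -> C) (l : C) : Prop := tends eventually (Csum u) l.

Lemma sum_n_Csum (u : nat -> C) n : sum_n (G := C_R_NormedModule) u n = Csum u (S n).
Proof.
  induction n as [|n IH].
  - rewrite sum_O. simpl. refine (_ : @eq C _ _). ring.
  - rewrite sum_Sn IH. reflexivity.
Qed.

Lemma tends_shift (u : nat -> C) k l :
  tends eventually (fun n => u (k + n)%nat) l -> tends eventually u l.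
Proof.
  intros H eps He. destruct (H eps He) as [N HN].
  exists (k + N)%nat. intros n Hn. specialize (HN (n - k)%nat).
  replace (k + (n - k))%nat with n in HN by lia. apply HN. lia.
Qed.

Lemma tends_subseq (u : nat -> C) (g : nat -> nat) l : (forall n, (n <= g n)%nat) ->
  tends eventually u l -> tends eventually (fun n => u (g n)) l.
Proof.
  intros Hg H eps He. destruct (H eps He) as [N HN].
  exists N. intros n Hn. apply HN. specialize (Hg n). lia.
Qed.

Lemma is_series_csum (u : nat -> C) l : is_series (V := C_R_NormedModule) u l <-> is_csum u l.
Proof.
  split.
  - intros H. apply (tends_shift _ 1).
    apply (tends_ext eventually (sum_n (G := C_R_NormedModule) u)).
    + apply filter_forall. intros n. apply sum_n_Csum.
    + apply (tends_filterlim eventually). exact H.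
  - intros H. apply (tends_filterlim eventually).
    apply (tends_ext eventually (fun n => Csum u (S n))).
    + apply filter_forall. intros n. symmetry. apply sum_n_Csum.
    + apply (tends_subseq _ S); [lia | exact H].
Qed.

Lemma CSeries_unique u l : is_csum u l -> CSeries u = l.
Proof.
  intros H. apply (iota_unique (V := C_R_CompleteNormedModule)).
  - intros y Hy. apply is_series_csum in Hy. exact (tends_unique _ _ _ _ Hy H).
  - apply is_series_csum. exact H.
Qed.

Lemma Csum_ext u v n : (forall k, (k < n)%nat -> u k = v k) -> Csum u n = Csum v n.
Proof.
  induction n as [|n IH]; intros H; [reflexivity|]. simpl. rewrite IH; [|auto]. rewrite H; auto.
Qed.

Lemma Csum_plus u v n : Csum (fun k => u k + v k)%C n = (Csum u n + Csum v n)%C.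
Proof. induction n as [|n IH]; simpl; [|rewrite IH]; ring. Qed.

Lemma Csum_scal c u n : Csum (fun k => c * u k)%C n = (c * Csum u n)%C.
Proof. induction n as [|n IH]; simpl; [|rewrite IH]; ring. Qed.

Lemma is_csum_ext u v l : (forall k, u k = v k) -> is_csum u l -> is_csum v l.
Proof.
  intros H. apply (tends_ext eventually). apply filter_forall. intros n. apply Csum_ext. auto.
Qed.

Lemma is_csum_plus u v l m : is_csum u l -> is_csum v m -> is_csum (fun k => u k + v k)%C (l + m)%C.
Proof.
  intros Hu Hv. eapply (tends_ext eventually); [|exact (tends_plus eventually _ _ _ _ Hu Hv)].
  apply filter_forall. intros n. symmetry. apply Csum_plus.
Qed.

Lemma is_csum_scal c u l : is_csum u l -> is_csum (fun k => c * u k)%C (c * l)%C.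
Proof.
  intros Hu. eapply (tends_ext eventually); [|exact (tends_scal eventually c _ _ Hu)].
  apply filter_forall. intros n. symmetry. apply Csum_scal.
Qed.

Lemma is_csum_minus u v l m : is_csum u l -> is_csum v m -> is_csum (fun k => u k - v k)%C (l - m)%C.
Proof.
  intros Hu Hv. replace (l - m)%C with (l + - (1) * m)%C by ring.
  eapply is_csum_ext; [|apply is_csum_plus; [exact Hu | apply (is_csum_scal (- (1))); exact Hv]].
  intros k. cbv beta. ring.
Qed.

Lemma is_csum_Csum (f : nat -> nat -> C) l N : (forall i, is_csum (f i) (l i)) ->
  is_csum (fun k => Csum (fun i => f i k) N) (Csum l N).
Proof.
  intros H. induction N as [|N IH]; simpl.
  - intros eps He. apply filter_forall. intros n.
    replace (Csum (fun _ => 0%C) n - 0)%C with (RtoC 0); [rewrite Cmod_0; exact He|].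
    induction n as [|n IHn]; simpl; [ring|]. rewrite {1}IHn. ring.
  - apply is_csum_plus; auto.
Qed.

Lemma is_csum_behead u l : is_csum u l -> is_csum (fun k => u (S k)) (l - u O)%C.
Proof.
  intros H.
  assert (E : forall n, Csum (fun k => u (S k)) n = (Csum u (S n) - u O)%C).
  { intros n. induction n as [|n IH]; [simpl; ring|]. simpl in *. rewrite IH. ring. }
  eapply (tends_ext eventually); [apply filter_forall; intros n; symmetry; apply E|].
  apply (tends_minus eventually); [|apply tends_const; typeclasses eauto].
  apply (tends_subseq _ S); [lia | exact H].
Qed.

Fixpoint Rsum (v : nat -> R) (n : nat) : R :=
  match n with O => 0 | S k => Rsum v k + v k end.

Lemma Cmod_Csum_le u v M n : (forall k, Cmod (u k) <= v k) -> (M <= n)%nat ->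
  Cmod (Csum u n - Csum u M) <= Rsum v n - Rsum v M.
Proof.
  intros H HMn. induction HMn as [|n HMn IH].
  - replace (Csum u M - Csum u M)%C with (RtoC 0) by ring. rewrite Cmod_0. lra.
  - simpl. replace (Csum u n + u n - Csum u M)%C with ((Csum u n - Csum u M) + u n)%C by ring.
    eapply Rle_trans; [apply Cmod_triangle|]. specialize (H n). lra.
Qed.

Lemma Rsum_le v (s : R) n : (forall k, 0 <= v k) -> is_lim_seq (Rsum v) s -> Rsum v n <= s.
Proof.
  intros Hv Hs. apply (is_lim_seq_incr_compare (Rsum v) s Hs).
  intros k. simpl. specialize (Hv k). lra.
Qed.

Lemma is_csum_tail u v l (s : R) M : (forall k, Cmod (u k) <= v k) -> is_csum u l ->
  is_lim_seq (Rsum v) s -> Cmod (l - Csum u M) <= s - Rsum v M.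
Proof.
  intros H Hu Hs.
  apply (tends_Cmod_le eventually (fun n => Csum u n - Csum u M)%C).
  - apply (tends_minus eventually); [exact Hu | apply tends_const; typeclasses eauto].
  - exists M. intros n Hn. eapply Rle_trans; [apply (Cmod_Csum_le u v M n); auto|].
    assert (Rsum v n <= s); [|lra]. apply Rsum_le; [|exact Hs].
    intros k. eapply Rle_trans; [apply Cmod_ge_0 | apply H].
Qed.

Lemma is_csum_le u v l (s : R) : (forall k, Cmod (u k) <= v k) -> is_csum u l ->
  is_lim_seq (Rsum v) s -> Cmod l <= s.
Proof.
  intros H Hu Hs. pose proof (is_csum_tail u v l s 0 H Hu Hs) as K. simpl in K.
  replace (l - 0)%C with l in K by ring. lra.
Qed.

Lemma Rsum_sum_n v n : sum_n v n = Rsum v (S n).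
Proof.
  induction n as [|n IH].
  - rewrite sum_O. simpl. symmetry. apply Rplus_0_l.
  - rewrite sum_Sn IH. reflexivity.
Qed.

Lemma is_csum_ex u v (s : R) : (forall k, Cmod (u k) <= v k) -> is_lim_seq (Rsum v) s ->
  exists l, is_csum u l.
Proof.
  intros H Hs.
  destruct (ex_series_le (V := C_R_CompleteNormedModule) u v) as [l Hl].
  - intros n. specialize (H n). rewrite Cmod_norm in H. exact H.
  - exists s. change (is_lim_seq (sum_n v) s).
    apply (is_lim_seq_ext (fun n => Rsum v (S n))).
    + intros n. symmetry. apply Rsum_sum_n.
    + apply (is_lim_seq_incr_1 (Rsum v) s). exact Hs.
  - exists l. apply is_series_csum. exact Hl.
Qed.

(** * Convergence of the zeta series and summation of the expansion *)

Lemma Rpower_seq_lim s : s < 0 -> is_lim_seq (fun n => Rpower (INR (S n)) s) 0.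
Proof.
  intros Hs. apply (is_lim_seq_incr_1 (fun n => Rpower (INR n) s) 0).
  apply (filterlim_comp _ _ _ INR (fun x => Rpower x s) _ (Rbar_locally p_infty)).
  - apply is_lim_seq_INR.
  - apply Rpower_lim_inf. exact Hs.
Qed.

(** Mean value theorem for $t^{1-p}/(1-p)$ on $[k+1,k+2]$, whose derivative $t^{-p}$ is smallest at
    the right end. The bound telescopes. *)
Lemma Rpower_telescope p k : 1 < p ->
  Rpower (INR (S (S k))) (- p) <=
    / (p - 1) * (Rpower (INR (S k)) (1 - p) - Rpower (INR (S (S k))) (1 - p)).
Proof.
  intros Hp. set (x := INR (S k)).
  assert (Hx : 0 < x) by (apply lt_0_INR; lia).
  replace (INR (S (S k))) with (x + 1) by (unfold x; rewrite (S_INR (S k)); reflexivity).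
  destruct (MVT_gen (fun t => Rpower t (1 - p) / (1 - p)) x (x + 1) (fun t => Rpower t (- p)))
    as [c [Hc E]].
  - intros t Ht. rewrite Rmin_left in Ht; [|lra]. apply is_derive_Rpower_primitive; lra.
  - intros t Ht. rewrite Rmin_left in Ht; [|lra].
    apply continuity_pt_filterlim.
    apply (ex_derive_continuous (V := R_NormedModule) (fun t => Rpower t (1 - p) / (1 - p)) t). eexists. apply is_derive_Rpower_primitive; lra.
  - rewrite Rmin_left in Hc; [|lra]. rewrite Rmax_right in Hc; [|lra].
    replace (x + 1 - x) with 1 in E by ring. rewrite Rmult_1_r in E.
    replace (/ (p - 1) * (Rpower x (1 - p) - Rpower (x + 1) (1 - p))) with
      (Rpower (x + 1) (1 - p) / (1 - p) - Rpower x (1 - p) / (1 - p)) by (field; lra).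
    rewrite E. apply Rpower_le_opp; lra.
Qed.

Lemma zeta_real_ex p : 1 < p -> exists s : R, is_lim_seq (Rsum (fun k => Rpower (INR (S k)) (- p))) s.
Proof.
  intros Hp. set (v := fun k => Rpower (INR (S k)) (- p)).
  assert (H : forall n, Rsum v (S n) <= 1 + / (p - 1) * (1 - Rpower (INR (S n)) (1 - p))).
  { intros n. induction n as [|n IH].
    - simpl. unfold v. simpl. rewrite /Rpower ln_1 !Rmult_0_r exp_0. lra.
    - pose proof (Rpower_telescope p n Hp) as HT.
      change (Rsum v (S (S n))) with (Rsum v (S n) + Rpower (INR (S (S n))) (- p)). lra. }
  destruct (ex_finite_lim_seq_incr (Rsum v) (1 + / (p - 1))) as [s Hs].
  - intros n. simpl. assert (0 < v n) by apply exp_pos. lra.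
  - intros n. apply (Rle_trans _ (Rsum v (S n))).
    + simpl. assert (0 < v n) by apply exp_pos. lra.
    + eapply Rle_trans; [apply H|].
      assert (0 < Rpower (INR (S n)) (1 - p)) by apply exp_pos.
      assert (0 < / (p - 1)) by (apply Rinv_0_lt_compat; lra). nra.
  - exists s. exact Hs.
Qed.

Lemma zeta_is_csum s : 1 < Re s -> is_csum (fun k => Rcpow (INR (S k)) (- s)%C) (zeta s).
Proof.
  intros Hs. destruct (zeta_real_ex _ Hs) as [r Hr].
  destruct (is_csum_ex (fun k => Rcpow (INR (S k)) (- s)%C)
    (fun k => Rpower (INR (S k)) (- Re s)) r) as [l Hl]; [| exact Hr |].
  - intros k. rewrite Cmod_Rcpow. right. reflexivity.
  - unfold zeta. rewrite (CSeries_unique _ _ Hl). exact Hl.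
Qed.

Lemma J_sum a b : 1 < Re a -> 1 < Re b -> (forall k : nat, (2 <= k)%nat -> b <> RtoC (INR k)) ->
  exists S, is_csum (zeta_term a b) S /\
    is_csum (fun j => J (INR (Datatypes.S j)) a b)
      (Beta (a + b - 1) (1 - b) * zeta (a + b - 1) - S)%C.
Proof.
  intros Ha Hb Hint. set (P := (a + b - 1)%C).
  assert (HP : Re P = Re a + Re b - 1) by (unfold P; destruct a, b; simpl; ring).
  assert (Hc : forall k, (1 - b)%C <> RtoC (- INR k)).
  { intros k E. assert (Eb : b = RtoC (INR (S k))).
    { rewrite S_INR RtoC_plus. replace b with (1 - (1 - b))%C by ring. rewrite E RtoC_opp. ring. }
    destruct k as [|k].
    - rewrite Eb in Hb. simpl in Hb. lra.
    - apply (Hint (S (S k))); [lia | exact Eb]. }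
  assert (HnegRe : forall z, 0 < Re z -> forall k, z <> RtoC (- INR k)).
  { intros z Hz k E. rewrite E in Hz. simpl in Hz. pose proof (pos_INR k). lra. }
  destruct (INR_ge_ex (Re b)) as [K HK].
  (* Index of the form required by [pochhammer_ratio_lim]; $\Re b\le K$ ensures $\Re(1-b)+K\ge0$. *)
  set (N := fun n => (K + (n + 2))%nat).
  set (Rn := fun n => (pochhammer a (N n) / pochhammer (1 - b) (N n))%C).
  set (T := fun n j => (Rn n * J (INR (S j)) (a + RtoC (INR (N n))) (b - RtoC (INR (N n))))%C).
  set (w := fun n => (Rn n * Rcpow (INR n) (- P))%C).
  set (W := (Gamma (1 - b) / Gamma a)%C).
  assert (Hw : tends eventually w W).
  { pose proof (pochhammer_ratio_lim a (1 - b) K) as HL.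
    replace (1 - b - a)%C with (- P)%C in HL by (unfold P; ring). apply HL.
    - apply HnegRe. lra.
    - exact Hc.
    - lra.
    - destruct b; simpl in *; lra. }
  set (G := Gamma_integral P).
  assert (HP1 : 1 < Re P) by lra.
  destruct (zeta_real_ex _ HP1) as [zr Hzr].
  (* [J_uniform] is used at $(a+K+2,\,b-K-2)$, which has the same $P$: the index is $K+2+n$ but the
     power is one of $n$. Its uniform error, multiplied by $m^{-P}$ with $m=j+1$, is summable over
     [j]. *)
  assert (HTd : forall eps, 0 < eps -> eventually (fun n => forall j,
    Cmod (T n j - w n * G * Rcpow (INR (S j)) (- P)) <= Cmod (w n) * eps * Rpower (INR (S j)) (- Re P))).
  { intros eps He.
    set (a' := (a + RtoC (INR (K + 2)))%C). set (b' := (b - RtoC (INR (K + 2)))%C).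
    assert (EP : (a' + b' - 1)%C = P) by (unfold a', b', P; ring).
    destruct (J_uniform a' b' eps) as [n0 Hn0]; [| |exact He|].
    { unfold a'. pose proof (pos_INR (K + 2)). destruct a; simpl in *; lra. }
    { unfold a', b'. destruct a, b; simpl in *; lra. }
    rewrite EP in Hn0. fold G in Hn0.
    exists (S n0). intros n Hn j.
    assert (Hn1 : 0 < INR n) by (apply lt_0_INR; lia).
    assert (Hj : 0 < INR (S j)) by (apply lt_0_INR; lia).
    assert (Hj1 : 1 <= INR (S j)) by (rewrite S_INR; pose proof (pos_INR j); lra).
    specialize (Hn0 n ltac:(lia) (INR (S j)) Hj1).
    assert (EN : INR (N n) = INR (K + 2) + INR n) by (unfold N; rewrite !plus_INR; ring).
    assert (Ea : (a + RtoC (INR (N n)))%C = (a' + RtoC (INR n))%C).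
    { rewrite EN RtoC_plus. unfold a'. ring. }
    assert (Eb : (b - RtoC (INR (N n)))%C = (b' - RtoC (INR n))%C).
    { rewrite EN RtoC_plus. unfold b'. ring. }
    unfold T. rewrite Ea Eb.
    set (X := J _ _ _) in *.
    replace (Rn n * X - w n * G * Rcpow (INR (S j)) (- P))%C with
      (w n * (Rcpow (INR (S j) * INR n) P * X - G) * Rcpow (INR (S j)) (- P))%C.
    2: { unfold w. rewrite Rcpow_mult // !Rcpow_opp.
         pose proof (Rcpow_neq_0 (INR n) P). pose proof (Rcpow_neq_0 (INR (S j)) P).
         field. auto. }
    rewrite 2!Cmod_mult (Cmod_Rcpow _ (- P)). change (Re (- P)) with (- Re P).
    apply Rmult_le_compat_r; [left; apply exp_pos|].
    apply Rmult_le_compat_l; [apply Cmod_ge_0 | exact Hn0]. }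
  assert (Hlin : forall c, is_lim_seq (Rsum (fun j => c * Rpower (INR (S j)) (- Re P))) (c * zr)).
  { intros c. apply (is_lim_seq_ext (fun n => c * Rsum (fun j => Rpower (INR (S j)) (- Re P)) n)).
    - intros n. induction n as [|n IH]; simpl; [ring|]. rewrite -IH. simpl. ring.
    - apply (is_lim_seq_scal_l _ c zr). exact Hzr. }
  set (Z := fun n => CSeries (T n)).
  assert (HZ : forall eps, 0 < eps -> eventually (fun n => is_csum (T n) (Z n) /\
     Cmod (Z n - w n * G * zeta P) <= Cmod (w n) * eps * zr)).
  { intros eps He. eapply filter_imp; [|exact (HTd eps He)].
    intros n Hn.
    pose proof (is_csum_scal (w n * G) _ _ (zeta_is_csum P HP1)) as H1.
    destruct (is_csum_ex _ _ _ Hn (Hlin _)) as [D HD].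
    assert (HTn : is_csum (T n) (D + w n * G * zeta P)%C).
    { eapply is_csum_ext; [|apply is_csum_plus; [exact HD | exact H1]].
      intros k. cbv beta. ring. }
    unfold Z. rewrite (CSeries_unique _ _ HTn). split; [exact HTn|].
    replace (D + w n * G * zeta P - w n * G * zeta P)%C with D by ring.
    exact (is_csum_le _ _ _ _ Hn HD (Hlin _)). }
  assert (Hzr0 : 0 <= zr).
  { apply (Rle_trans _ (Rsum (fun k => Rpower (INR (S k)) (- Re P)) 0)); [simpl; lra|].
    apply Rsum_le; [|exact Hzr]. intros k. left; apply exp_pos. }
  assert (HZlim : tends eventually Z (W * G * zeta P)%C).
  { assert (H1 : tends eventually (fun n => w n * (G * zeta P))%C (W * (G * zeta P))%C).
    { apply (tends_mult eventually); [exact Hw | apply tends_const; typeclasses eauto]. }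
    assert (H2 : tends eventually (fun n => Z n - w n * (G * zeta P))%C 0).
    { intros eps He.
      (* [w n] converges to [W], hence is eventually bounded by [B]; the chosen tolerance then gives
         a total error of at most [eps / 2]. *)
      set (B := Cmod W + 1). assert (HB : 0 < B) by (unfold B; pose proof (Cmod_ge_0 W); lra).
      assert (He' : 0 < eps / (2 * B * (zr + 1))).
      { apply Rdiv_lt_0_compat; [lra|]. apply Rmult_lt_0_compat; lra. }
      eapply filter_imp; [|exact (filter_and _ _ (HZ _ He') (Hw 1 Rlt_0_1))].
      intros n [[_ H2] H3].
      replace (Z n - w n * (G * zeta P) - 0)%C with (Z n - w n * G * zeta P)%C by ring.
      eapply Rle_lt_trans; [exact H2|].
      assert (HwB : Cmod (w n) <= B).
      { replace (w n) with ((w n - W) + W)%C by ring.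
        eapply Rle_trans; [apply Cmod_triangle|]. unfold B. lra. }
      apply (Rle_lt_trans _ (B * (eps / (2 * B * (zr + 1))) * (zr + 1))).
      - apply Rmult_le_compat; try lra.
        + apply Rmult_le_pos; [apply Cmod_ge_0 | lra].
        + apply Rmult_le_compat_r; lra.
      - replace (B * (eps / (2 * B * (zr + 1))) * (zr + 1)) with (eps / 2) by (field; lra). lra. }
    pose proof (tends_plus eventually _ _ _ _ H2 H1) as H3.
    replace (0 + W * (G * zeta P))%C with (W * G * zeta P)%C in H3 by ring.
    eapply (tends_ext eventually); [|exact H3]. apply filter_forall. intros n. cbv beta. ring. }
  (* [J_expansion] summed over [m]: its left-hand side does not depend on [n]. *)
  assert (HX : forall n, is_csum (T n) (Z n) ->
    is_csum (fun j => J (INR (S j)) a b) (Z n - Csum (zeta_term a b) (N n))%C).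
  { intros n Hn.
    eapply is_csum_ext; [|apply is_csum_minus; [exact Hn|
      apply (is_csum_Csum (fun i j => pochhammer a i / pochhammer (1 - b) (S i)
        * Rcpow (1 + INR (S j)) (- (a + RtoC (INR i))))%C)]].
    - intros j. unfold T, Rn. symmetry. apply J_expansion; auto; try lra. apply pos_INR.
    - intros i. unfold zeta_term. apply is_csum_scal.
      assert (Hai : 1 < Re (a + RtoC (INR i))) by (pose proof (pos_INR i); destruct a; simpl in *; lra).
      (* As $m\ge1$, the base $1+m$ starts at $2$: the missing first term of the zeta series is the
         $1$ subtracted in [zeta_term]. *)
      pose proof (is_csum_behead _ _ (zeta_is_csum _ Hai)) as HB.
      cbv beta in HB. simpl (INR 1) in HB. rewrite Rcpow_1l in HB.
      eapply is_csum_ext; [|exact HB]. intros k. cbv beta.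
      rewrite (S_INR (S k)) Rplus_comm. reflexivity. }
  destruct (HZ 1 Rlt_0_1) as [n1 Hn1].
  (* The sum over [m] can be read off at the single index [n1]. At every later [n] the partial sum
     of order [N n] is then exactly [Z n - X], so the limit of [Z] gives the convergence of the
     series together with its value. *)
  set (X := (Z n1 - Csum (zeta_term a b) (N n1))%C).
  assert (HX1 : is_csum (fun j => J (INR (S j)) a b) X) by (apply HX; apply Hn1; lia).
  exists (W * G * zeta P - X)%C. split.
  - apply (tends_shift _ (K + 2)).
    apply (tends_ext eventually (fun n => Z n - X)%C).
    + exists n1. intros n Hn.
      pose proof (tends_unique _ _ _ _ HX1 (HX n (proj1 (Hn1 n Hn)))) as E.
      rewrite E. replace (K + 2 + n)%nat with (N n) by (unfold N; lia). ring.
    + apply (tends_minus eventually); [exact HZlim | apply tends_const; typeclasses eauto].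
  - replace (Beta P (1 - b) * zeta P - (W * G * zeta P - X))%C with X; [exact HX1|].
    unfold Beta. replace (P + (1 - b))%C with a by (unfold P; ring).
    replace (Gamma P) with G.
    + unfold W, Cdiv. ring.
    + assert (E0 : (P + RtoC (INR 0))%C = P) by (simpl; ring).
      pose proof (Gamma_pochhammer P 0 (HnegRe P ltac:(lra))) as E.
      rewrite E0 in E. unfold G. rewrite E; [simpl; ring | lra].
Qed.

(** * Truncation of the double series *)

Definition zeta1_partial (s : C) (M : nat) (x : R) : C :=
  Csum (fun k => Rcpow (INR (S k) + x) (- s)%C) M.

Lemma Cmod_zeta1_term s x k : 0 <= Re s -> 0 <= x ->
  Cmod (Rcpow (INR (S k) + x) (- s)%C) <= Rpower (INR (S k)) (- Re s).
Proof.
  intros Hs Hx. rewrite Cmod_Rcpow. change (Re (- s)) with (- Re s).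
  assert (0 < INR (S k)) by (apply lt_0_INR; lia). apply Rpower_le_opp; lra.
Qed.

(** Each term at $x\ge0$ is at most the modulus of the term at $x=0$, so the bound is uniform in
    [x]. *)
Lemma zeta1_tail s (r : R) M x : 1 < Re s -> 0 <= x ->
  is_lim_seq (Rsum (fun k => Rpower (INR (S k)) (- Re s))) r ->
  Cmod (zeta1 s x - zeta1_partial s M x) <= r - Rsum (fun k => Rpower (INR (S k)) (- Re s)) M.
Proof.
  intros Hs Hx Hr. 
  assert (HB : forall k, Cmod (Rcpow (INR (S k) + x) (- s)%C) <= Rpower (INR (S k)) (- Re s)).
  { intros k. apply Cmod_zeta1_term; lra. }
  destruct (is_csum_ex _ _ _ HB Hr) as [l Hl].
  unfold zeta1. rewrite (CSeries_unique _ _ Hl).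
  exact (is_csum_tail _ _ _ _ M HB Hl Hr).
Qed.

Definition zprod (a b : C) (k j : nat) (x : R) : C :=
  (Rcpow (INR (S k) + x) (- a) * Rcpow (INR (S j) + x) (- b))%C.

Definition zprod_int (a b : C) (k j : nat) : C := cint (zprod a b k j) 0 1.

Lemma ccont_zprod a b k j x : 0 <= x -> ccont (zprod a b k j) x.
Proof.
  intros Hx. assert (0 < INR (S k)) by (apply lt_0_INR; lia).
  assert (0 < INR (S j)) by (apply lt_0_INR; lia).
  apply ccont_mult; apply ccont_Rcpow_comp; try lra;
    apply (ex_derive_continuous (V := R_NormedModule)); auto_derive; auto.
Qed.

Lemma zprod_int_sym a b k j : zprod_int a b k j = zprod_int b a j k.
Proof.
  unfold zprod_int. apply (RInt_ext (V := C_R_CompleteNormedModule)).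
  intros x _. apply Cmult_comm.
Qed.

Lemma is_cint_Csum f l a b n : (forall k, is_cint (f k) a b (l k)) ->
  is_cint (fun x => Csum (fun k => f k x) n) a b (Csum l n).
Proof.
  intros H. induction n as [|n IH]; simpl.
  - pose proof (is_RInt_const (V := C_R_NormedModule) a b (RtoC 0)) as K.
    replace (scal (b - a) (RtoC 0 : C_R_NormedModule)) with (RtoC 0 : C_R_NormedModule) in K;
      [exact K|].
    apply C_ext; rewrite /= /scal /= /mult /=; ring.
  - apply is_cint_plus; auto.
Qed.

Lemma is_cint_partial_prod a b M :
  is_cint (fun x => zeta1_partial a M x * zeta1_partial b M x)%C 0 1
    (Csum (fun k => Csum (fun j => zprod_int a b k j) M) M).
Proof.
  apply (is_cint_ext (fun x => Csum (fun k => Csum (fun j => zprod a b k j x) M) M)).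
  - intros x _. unfold zeta1_partial.
    rewrite Cmult_comm -Csum_scal. apply Csum_ext. intros k _.
    rewrite Cmult_comm -Csum_scal. reflexivity.
  - apply (is_cint_Csum (fun k x => Csum (fun j => zprod a b k j x) M)). intros k.
    apply (is_cint_Csum (fun j x => zprod a b k j x)). intros j.
    apply is_cint_cont. intros x Hx. rewrite Rmin_left in Hx; [|lra].
    apply ccont_zprod. lra.
Qed.

Lemma Csum_rev u n : Csum (fun k => u (n - 1 - k)%nat) n = Csum u n.
Proof.
  assert (H : forall n u, Csum u (S n) = (u O + Csum (fun k => u (S k)) n)%C).
  { clear. intros n u. induction n as [|n IH]; [simpl; ring|].
    change (Csum u (S (S n))) with (Csum u (S n) + u (S n))%C. rewrite IH. simpl. ring. }
  induction n as [|n IH]; [reflexivity|].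
  rewrite H. simpl Csum. replace (S n - 1 - 0)%nat with n by lia.
  rewrite (Csum_ext _ (fun k => u (n - 1 - k)%nat)).
  - rewrite IH. ring.
  - intros k Hk. f_equal. lia.
Qed.

(** The square is cut into its diagonals, [m + 1] being the distance from the main one. Passing from
    [M] to [M + 1] adds a row and a column; read along the diagonals their entries appear in reverse
    order, hence [Csum_rev]. *)
Lemma Csum_square (c : nat -> nat -> C) M :
  Csum (fun k => Csum (fun j => c k j) M) M =
    (Csum (fun k => c k k) M
     + Csum (fun m => Csum (fun j => c (j + S m)%nat j) (M - S m)) M
     + Csum (fun m => Csum (fun j => c j (j + S m)%nat) (M - S m)) M)%C.
Proof.
  induction M as [|M IH]; [simpl; ring|].
  (* Each existing diagonal gains one entry at its end, and the new diagonal [m = M] is still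
     empty. *)
  assert (Hstep : forall d : nat -> nat -> C,
    Csum (fun m => Csum (fun j => d m j) (S M - S m)) (S M) =
    (Csum (fun m => Csum (fun j => d m j) (M - S m)) M + Csum (fun m => d m (M - S m)%nat) M)%C).
  { intros d. rewrite -Csum_plus. simpl Csum at 1. rewrite Nat.sub_diag. simpl (Csum _ 0).
    rewrite Cplus_0_r. apply Csum_ext. intros m Hm.
    replace (M - m)%nat with (S (M - S m)) by lia. reflexivity. }
  rewrite (Hstep (fun m j => c (j + S m)%nat j)) (Hstep (fun m j => c j (j + S m)%nat)).
  rewrite (Csum_ext (fun m => c (M - S m + S m)%nat (M - S m)%nat) (fun m => c M (M - 1 - m)%nat)).
  2: { intros m Hm. f_equal; lia. }
  rewrite (Csum_ext (fun m => c (M - S m)%nat (M - S m + S m)%nat) (fun m => c (M - 1 - m)%nat M)).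
  2: { intros m Hm. f_equal; lia. }
  rewrite (Csum_rev (fun i => c M i)) (Csum_rev (fun i => c i M)).
  simpl. rewrite Csum_plus IH. ring.
Qed.

(** The [j]-th integrand is [jf] translated by $j+1$, so the integrals run over the consecutive
    intervals $[j+1,j+2]$. *)
Lemma zprod_int_sum a b m n :
  Csum (fun j => zprod_int a b (j + m) j) n = cint (jf (INR m) a b) 1 (1 + INR n).
Proof.
  assert (Cj : forall x, 1 <= x -> ccont (jf (INR m) a b) x).
  { intros x Hx. apply ccont_jf; [apply pos_INR | lra]. }
  induction n as [|n IH].
  - simpl. replace (1 + 0) with 1 by ring. symmetry. apply (RInt_point (V := C_R_CompleteNormedModule)).
  - simpl Csum. rewrite IH. pose proof (pos_INR n).
    rewrite (cint_split (jf (INR m) a b) (1 + INR n) (1 + INR (S n))); auto; try (rewrite ?S_INR; lra).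
    f_equal. unfold zprod_int. apply cint_unique.
    eapply is_cint_ext; [|apply (is_RInt_comp_lin (V := C_R_NormedModule) (jf (INR m) a b) 1 (1 + INR n))].
    + intros x _. unfold zprod.
      transitivity (jf (INR m) a b (1 * x + (1 + INR n)) : C).
      { destruct (jf (INR m) a b (1 * x + (1 + INR n))).
        apply C_ext; rewrite /= /scal /= /mult /=; ring. }
      unfold jf. rewrite Cmult_comm. rewrite !S_INR plus_INR. f_equal; f_equal; ring.
    + replace (1 * 0 + (1 + INR n)) with (1 + INR n) by ring.
      replace (1 * 1 + (1 + INR n)) with (1 + INR (S n)) by (rewrite S_INR; ring).
      apply is_cint_ge1; auto; rewrite ?S_INR; lra.
Qed.

Lemma J_diag a b : 1 < Re a + Re b -> J 0 a b = (1 / (a + b - 1))%C.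
Proof.
  intros Hab. apply J_unique. unfold is_J.
  set (P := (a + b - 1)%C).
  assert (HP : 0 < Re P) by (unfold P; destruct a, b; simpl in *; lra).
  assert (HP0 : P <> 0%C) by (intros E; rewrite E in HP; simpl in HP; lra).
  apply (tends_ext (Rbar_locally p_infty) (fun L => / P - / P * Rcpow L (- P))%C).
  - exists 1. intros L HL. symmetry. apply cint_unique.
    replace (/ P - / P * Rcpow L (- P))%C with (- / P * Rcpow L (- P) - - / P * Rcpow 1 (- P))%C.
    2: { rewrite Rcpow_1l. ring. }
    apply (is_cint_FTC (fun x => - / P * Rcpow x (- P))%C); intros x Hx; rewrite Rmin_left in Hx; try lra.
    + replace (jf 0 a b x) with (- / P * (- P * Rcpow x (- P - 1)))%C.
      2: { unfold jf. rewrite Rplus_0_r -Rcpow_plus.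
           replace (- b + - a)%C with (- P - 1)%C by (unfold P; ring). field. exact HP0. }
      apply is_cderive_scal. apply is_cderive_Rcpow. lra.
    + apply ccont_jf; lra.
  - replace (1 / P)%C with (/ P - / P * 0)%C by (field; exact HP0).
    apply (tends_minus (Rbar_locally p_infty)); [apply tends_const; typeclasses eauto|].
    apply (tends_scal (Rbar_locally p_infty)).
    apply (tends_le (Rbar_locally p_infty) _ _ (fun x => Rpower x (- Re P))).
    + exists 0. intros x Hx. replace (Rcpow x (- P) - 0)%C with (Rcpow x (- P)) by ring.
      rewrite Cmod_Rcpow. right. reflexivity.
    + apply Rpower_lim_inf. lra.
Qed.

Lemma Cmod_Csum_const_le u v B n : (forall k, (k < n)%nat -> Cmod (u k - v k) <= B) ->
  Cmod (Csum u n - Csum v n) <= INR n * B.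
Proof.
  induction n as [|n IH]; intros H.
  - simpl. replace (0 - 0)%C with (RtoC 0) by ring. rewrite Cmod_0. lra.
  - rewrite S_INR. simpl.
    replace (Csum u n + u n - (Csum v n + v n))%C with ((Csum u n - Csum v n) + (u n - v n))%C by ring.
    eapply Rle_trans; [apply Cmod_triangle|].
    assert (Cmod (u n - v n) <= B) by auto. assert (Cmod (Csum u n - Csum v n) <= INR n * B) by auto. lra.
Qed.

(** The integral at distance $m+1$ stops at $L=1+M-(m+1)$, so $L+(m+1)=M+1$ for every [m]. By
    [J_tail] all [M] missing tails share the factor $(M+1)^{-\Re a}$, and together they are at most
    $(M+1)^{1-\Re a}/(\Re b-1)$, which tends to $0$. *)
Lemma lower_sum_lim a b l : 1 < Re a -> 1 < Re b -> is_csum (fun m => J (INR (S m)) a b) l ->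
  tends eventually (fun M => Csum (fun m => Csum (fun j => zprod_int a b (j + S m) j) (M - S m)) M) l.
Proof.
  intros Ha Hb Hl.
  set (D := fun M => Csum (fun m => Csum (fun j => zprod_int a b (j + S m) j) (M - S m)) M).
  assert (HD : tends eventually (fun M => D M - Csum (fun m => J (INR (S m)) a b) M)%C 0).
  { apply (tends_le eventually _ _ (fun M => / (Re b - 1) * Rpower (INR (S M)) (1 - Re a))).
    - apply filter_forall. intros M.
      replace (D M - Csum (fun m => J (INR (S m)) a b) M - 0)%C with
        (D M - Csum (fun m => J (INR (S m)) a b) M)%C by ring.
      assert (HM : 0 < INR (S M)) by (apply lt_0_INR; lia).
      apply (Rle_trans _ (INR M * (Rpower (INR (S M)) (- Re a) * / (Re b - 1)))).
      + apply Cmod_Csum_const_le. intros m Hm.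
        rewrite zprod_int_sum -Cmod_opp.
        replace (- (cint (jf (INR (S m)) a b) 1 (1 + INR (M - S m)) - J (INR (S m)) a b))%C with
          (J (INR (S m)) a b - cint (jf (INR (S m)) a b) 1 (1 + INR (M - S m)))%C by ring.
        pose proof (pos_INR (M - S m)).
        eapply Rle_trans; [apply J_tail; try lra; apply pos_INR|].
        replace (1 + INR (M - S m) + INR (S m)) with (INR (S M)).
        2: { rewrite minus_INR; [|lia]. rewrite (S_INR M). ring. }
        apply Rmult_le_compat_l; [left; apply exp_pos|].
        assert (0 < / (Re b - 1)) by (apply Rinv_0_lt_compat; lra).
        assert (Rpower (1 + INR (M - S m)) (1 - Re b) <= 1); [|unfold Rdiv; nra].
        replace (1 - Re b) with (- (Re b - 1)) by ring.
        apply (Rle_trans _ (Rpower 1 (- (Re b - 1)))); [apply Rpower_le_opp; lra|].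
        rewrite /Rpower ln_1 Rmult_0_r exp_0. lra.
      + replace (1 - Re a) with (1 + - Re a) by ring. rewrite Rpower_plus Rpower_1 //.
        replace (INR M * (Rpower (INR (S M)) (- Re a) * / (Re b - 1))) with
          (/ (Re b - 1) * (INR M * Rpower (INR (S M)) (- Re a))) by ring.
        apply Rmult_le_compat_l; [left; apply Rinv_0_lt_compat; lra|].
        apply Rmult_le_compat_r; [left; apply exp_pos|]. rewrite S_INR. lra.
    - replace 0 with (/ (Re b - 1) * 0) by ring.
      apply (is_lim_seq_scal_l _ _ 0). apply Rpower_seq_lim. lra. }
  pose proof (tends_plus eventually _ _ _ _ HD Hl) as H.
  replace (0 + l)%C with l in H by ring.
  eapply (tends_ext eventually); [|exact H]. apply filter_forall. intros M. cbv beta. fold (D M). ring.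
Qed.

(** The products of partial sums converge uniformly on $[0,1]$ by [zeta1_tail], so limit and
    integral commute. *)
Lemma zeta1_prod_int a b l : 1 < Re a -> 1 < Re b ->
  tends eventually (fun M => Csum (fun k => Csum (fun j => zprod_int a b k j) M) M) l ->
  is_cint (fun x => zeta1 a x * zeta1 b x)%C 0 1 l.
Proof.
  intros Ha Hb Hl.
  destruct (zeta_real_ex _ Ha) as [ra Hra]. destruct (zeta_real_ex _ Hb) as [rb Hrb].
  set (va := Rsum (fun k => Rpower (INR (S k)) (- Re a))) in *.
  set (vb := Rsum (fun k => Rpower (INR (S k)) (- Re b))) in *.
  (* [filterlim_RInt] asks for uniform convergence on the whole line. *)
  set (cl := fun x => Rmax 0 (Rmin x 1)).
  assert (Hcl0 : forall x, 0 <= cl x) by (intros x; apply Rmax_l).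
  assert (Hcl : forall x, 0 <= x <= 1 -> cl x = x).
  { intros x Hx. unfold cl. rewrite Rmin_left; [|lra]. rewrite Rmax_right; lra. }
  assert (Hpos : forall (r : R) p M, is_lim_seq (Rsum (fun k => Rpower (INR (S k)) p)) r ->
    0 <= Rsum (fun k => Rpower (INR (S k)) p) M <= r).
  { intros r p M Hr. split.
    - clear Hr. induction M as [|M IH]; [simpl; lra|].
      change (0 <= Rsum (fun k => Rpower (INR (S k)) p) M + Rpower (INR (S M)) p).
      apply Rplus_le_le_0_compat; [exact IH | left; apply exp_pos].
    - apply Rsum_le; [|exact Hr]. intros k. left; apply exp_pos. }
  pose proof (Hpos _ _ O Hra) as Pa. pose proof (Hpos _ _ O Hrb) as Pb.
  destruct (filterlim_RInt (V := C_R_CompleteNormedModule)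
    (fun M x => (zeta1_partial a M (cl x) * zeta1_partial b M (cl x))%C) 0 1 eventually _
    (fun x => (zeta1 a (cl x) * zeta1 b (cl x))%C)
    (fun M => Csum (fun k => Csum (fun j => zprod_int a b k j) M) M)) as [I [HI1 HI2]].
  - intros M. eapply is_cint_ext; [|apply is_cint_partial_prod].
    intros x Hx. rewrite Rmin_left in Hx; [|lra]. rewrite Rmax_right in Hx; [|lra].
    rewrite Hcl //. lra.
  - apply filterlim_locally. intros eps.
    (* Majorant, free of [x], from $AB-A'B'=(A-A')B+A'(B-B')$. *)
    assert (HE : is_lim_seq (fun M => (ra - va M) * rb + ra * (rb - vb M)) ((ra - ra) * rb + ra * (rb - rb))).
    { apply is_lim_seq_plus'.
      - apply (is_lim_seq_scal_r _ rb (ra - ra)). apply is_lim_seq_minus'; [apply is_lim_seq_const | exact Hra].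
      - apply (is_lim_seq_scal_l _ ra (rb - rb)). apply is_lim_seq_minus'; [apply is_lim_seq_const | exact Hrb]. }
    replace ((ra - ra) * rb + ra * (rb - rb)) with 0 in HE by ring.
    specialize (HE _ (locally_ball 0 eps)). unfold filtermap in HE.
    eapply filter_imp; [|exact HE]. intros M HM x.
    rewrite /ball /= /AbsRing_ball /abs /minus /plus /opp /= in HM. apply Rabs_def2 in HM.
    apply (norm_compat1 (V := C_R_NormedModule)).
    set (A := zeta1 a (cl x)). set (B := zeta1 b (cl x)).
    set (A' := zeta1_partial a M (cl x)). set (B' := zeta1_partial b M (cl x)).
    change (norm ((A' * B' - A * B)%C : C_R_NormedModule) < eps). rewrite -Cmod_norm.
    assert (HA : Cmod (A - A') <= ra - va M) by (apply zeta1_tail; auto).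
    assert (HB : Cmod (B - B') <= rb - vb M) by (apply zeta1_tail; auto).
    assert (HB0 : Cmod B <= rb).
    { pose proof (zeta1_tail b rb 0 (cl x) Hb (Hcl0 x) Hrb) as H. simpl in H. unfold zeta1_partial in H. simpl in H.
      fold B in H. replace (B - 0)%C with B in H by ring. lra. }
    assert (HA0 : Cmod A' <= ra).
    { unfold A', zeta1_partial.
      pose proof (Cmod_Csum_le (fun k => Rcpow (INR (S k) + cl x) (- a)%C) (fun k => Rpower (INR (S k)) (- Re a)) 0 M
        (fun k => Cmod_zeta1_term a (cl x) k ltac:(lra) (Hcl0 x)) ltac:(lia)) as H.
      simpl (Csum _ 0) in H. simpl (Rsum _ 0) in H.
      match type of H with Cmod (?X - RtoC 0)%C <= _ => replace (X - RtoC 0)%C with X in H by ring end.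
      fold va in H. pose proof (Hpos _ _ M Hra). fold va in H0. lra. }
    replace (A' * B' - A * B)%C with (- ((A - A') * B + A' * (B - B')))%C by ring.
    rewrite Cmod_opp. eapply Rle_lt_trans; [apply Cmod_triangle|]. rewrite !Cmod_mult.
    pose proof (Cmod_ge_0 (A - A')). pose proof (Cmod_ge_0 (B - B')).
    pose proof (Cmod_ge_0 A'). pose proof (Cmod_ge_0 B).
    assert (Cmod (A - A') * Cmod B <= (ra - va M) * rb) by (apply Rmult_le_compat; lra).
    assert (Cmod A' * Cmod (B - B') <= ra * (rb - vb M)) by (apply Rmult_le_compat; lra).
    lra.
  - replace l with I.
    + eapply is_cint_ext; [|exact HI2]. intros x Hx.
      rewrite Rmin_left in Hx; [|lra]. rewrite Rmax_right in Hx; [|lra].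
      cbv beta. rewrite Hcl //. lra.
    + apply (tends_unique eventually _ _ _ (proj1 (tends_filterlim eventually _ _) HI1) Hl).
Qed.

Theorem theorem1 (a b : C)
  (ha : 1 < Re a) (hb : 1 < Re b)
  (ha_int : forall k : nat, (2 <= k)%nat -> a <> RtoC (INR k))
  (hb_int : forall k : nat, (2 <= k)%nat -> b <> RtoC (INR k)) :
  ex_RInt (V := C_R_NormedModule)
    (fun x : R => (zeta1 a x * zeta1 b x)%C) 0 1 /\
  Cex_series (zeta_term a b) /\
  Cex_series (zeta_term b a) /\
  RInt (V := C_R_CompleteNormedModule)
    (fun x : R => (zeta1 a x * zeta1 b x)%C) 0 1 =
  (RtoC 1 / (a + b - RtoC 1)
   + (Beta (a + b - RtoC 1) (RtoC 1 - a) + Beta (a + b - RtoC 1) (RtoC 1 - b))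
     * zeta (a + b - RtoC 1)
   - CSeries (zeta_term a b)
   - CSeries (zeta_term b a))%C.
Proof.
  destruct (J_sum a b ha hb hb_int) as [S1 [HS1 HJ1]].
  destruct (J_sum b a hb ha ha_int) as [S2 [HS2 HJ2]].
  replace (b + a - 1)%C with (a + b - 1)%C in HJ2 by ring.
  rewrite (CSeries_unique _ _ HS1) (CSeries_unique _ _ HS2).
  set (P := (a + b - 1)%C) in *.
  assert (HI : is_cint (fun x => zeta1 a x * zeta1 b x)%C 0 1
    (1 / P + (Beta P (1 - b) * zeta P - S1) + (Beta P (1 - a) * zeta P - S2))%C).
  { apply zeta1_prod_int; auto.
    eapply (tends_ext eventually); [apply filter_forall; intros M; symmetry; apply Csum_square|].
    apply (tends_plus eventually); [apply (tends_plus eventually)|].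
    (* The main diagonal is the case [m = 0] of [zprod_int_sum]: its partial sums are the integrals
       up to $1+M$, a sequence of upper limits tending to infinity. *)
    - unfold P. rewrite -J_diag; [|lra].
      assert (HJ : is_J 0 a b (J 0 a b)) by (apply J_correct; lra).
      eapply (tends_ext eventually).
      2: { eapply (tends_comp eventually (Rbar_locally p_infty) (fun n => 1 + INR n)); [|exact HJ].
           intros Q [T HT]. destruct (INR_ge_ex T) as [n0 Hn0]. exists n0. intros n Hn.
           apply HT. apply le_INR in Hn. lra. }
      apply filter_forall. intros M. cbv beta.
      pose proof (zprod_int_sum a b 0 M) as E. simpl (INR 0) in E. rewrite -E.
      apply Csum_ext. intros k _. rewrite Nat.add_0_r. reflexivity.
    - apply lower_sum_lim; auto.
    (* The upper triangle is the lower one with [a] and [b] exchanged. *)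
    - eapply (tends_ext eventually); [|apply (lower_sum_lim b a); [exact hb | exact ha | exact HJ2]].
      apply filter_forall. intros M. apply Csum_ext. intros m _. apply Csum_ext. intros j _.
      apply zprod_int_sym. }
  split; [eexists; exact HI|]. split; [exists S1; apply is_series_csum; exact HS1|].
  split; [exists S2; apply is_series_csum; exact HS2|].
  rewrite (cint_unique _ _ _ _ HI). refine (_ : @eq C _ _). ring.
Qed.
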